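(* Let $E$ be a simple, closed, densely defined, symmetric operator with infinite deficiency indices on a complex separable infinite dimensional Hilbert space $\mathfrak{X}$, let $Y\subseteq\mathfrak{X}$ be a closed infinite dimensional subspace, and let $\Omega\subseteq\mathbb{C}$ be a nonempty open set, symmetric about the real axis, consisting of $Y$-regular points of $E$. Then the reproducing kernel Hilbert space $\mathcal{H}_1$ of $\mathfrak{X}\oplus\mathfrak{X}$ valued functions on $\Omega$ constructed from $E$ (defined in the context) is an $\mathcal{H}_0(U)$ space, with signature operator $J=J_1=\begin{bmatrix}0&I\\ I&0\end{bmatrix}$ on $\mathfrak{X}\oplus\mathfrak{X}$.
   Context: $B(\mathfrak{K})$ is the space of bounded linear operators on a Hilbert space $\mathfrak{K}$. A symmetric operator $E$ is simple if it has no nonzero reducing subspace on which it is self-adjoint (equivalently $\bigcap_{\xi\in\mathbb{C}\setminus\mathbb{R}}\mathrm{rng}(E-\xi I)=\{0\}$). Write $\mathfrak{M}_\xi=\mathrm{rng}(E-\xi I)$. For a closed subspace $Y$ of $\mathfrak{X}$, a point $\xi\in\mathbb{C}$ is called $Y$-regular for $E$ if $\mathfrak{M}_\xi$ is closed and $\mathfrak{X}=\mathfrak{M}_\xi\dotplus Y$ (direct sum). Every $Y$-regular point is a point of regular type of $E$, i.e. there is $c_\xi>0$ with $\|(E-\xi I)g\|\ge c_\xi\|g\|$ for all $g\in\mathcal{D}(E)$. For $\xi\in\Omega$, $P_Y(\xi)\in B(\mathfrak{X})$ is the projection onto $Y$ along $\mathfrak{M}_\xi$, and $\tau_Y(\xi)\in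 B(\mathfrak{X})$ is $\tau_Y(\xi)f=(E-\xi I)^{-1}(I-P_Y(\xi))f$; thus $f=(E-\xi I)\tau_Y(\xi)f+P_Y(\xi)f$. Construction of $\mathcal{H}_1$: for $f\in\mathfrak{X}$ and $\xi\in\Omega$ put $\begin{bmatrix}f_Y\\ \tilde f_Y\end{bmatrix}(\xi)=\begin{bmatrix}P_Y(\xi)f\\ \frac{1}{\pi i}\tau_Y(\xi)f\end{bmatrix}\in\mathfrak{X}\oplus\mathfrak{X}$. Then $\mathcal{H}_1=\left\{\begin{bmatrix}f_Y\\ \tilde f_Y\end{bmatrix}:f\in\mathfrak{X}\right\}$, with inner product $\left\langle\begin{bmatrix}f_Y\\ \tilde f_Y\end{bmatrix},\begin{bmatrix}g_Y\\ \tilde g_Y\end{bmatrix}\right\rangle_{\mathcal{H}_1}=2\langle f,g\rangle_{\mathfrak{X}}$ (well defined because $f\mapsto\begin{bmatrix}f_Y\\ \tilde f_Y\end{bmatrix}$ is injective). $\mathcal{H}(U)$ spaces: let $J$ be a unitary self-adjoint operator on a Hilbert space $\mathfrak{K}$ and $U:\Omega\to B(\mathfrak{K})$ analytic with $U(\lambda)JU(\bar\lambda)^*=J=U(\bar\lambda)^*JU(\lambda)$ for all $\lambda\in\Omega$. Put $\rho_\xi(\lambda)=-2\pi i(\lambda-\bar\xi)$ and $K^U_\xi(\lambda)=\frac{J-U(\lambda)JU(\xi)^*}{\rho_\xi(\lambda)}$ if $\lambda\ne\bar\xi$, $K^U_\xi(\bar\xi)=\frac{U'(\bar\xi)JU(\xi)^*}{2\pi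 i}$. When this kernel is positive on $\Omega\times\Omega$ (i.e. $\sum_{i,j}\langle K^U_{\omega_j}(\omega_i)u_j,u_i\rangle\ge0$ for all finite choices of $\omega_i\in\Omega$, $u_i\in\mathfrak{K}$), $\mathcal{H}(U)$ denotes the unique reproducing kernel Hilbert space of $\mathfrak{K}$-valued analytic functions on $\Omega$ with reproducing kernel $K^U$ (i.e. $K^U_\omega u\in\mathcal{H}(U)$ and $\langle f,K^U_\omega u\rangle_{\mathcal{H}(U)}=\langle f(\omega),u\rangle$ for all $\omega\in\Omega$, $u\in\mathfrak{K}$, $f\in\mathcal{H}(U)$). A space of functions on $\Omega$ is an $\mathcal{H}_0(U)$ space (with signature operator $J$) if it equals $\mathcal{H}(U)$ for some such $U$ for which, for every $\lambda\in\Omega$, the operator $I-U(\lambda)$ is not compact. *)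

(* Defs.v *)
From HB Require Import structures.
From mathcomp Require Import all_boot all_order all_algebra.
From mathcomp Require Import sesquilinear complex.
From mathcomp Require Import all_classical all_reals all_analysis.
From mathcomp Require Import ring.

Set Implicit Arguments.
Unset Strict Implicit.
Unset Printing Implicit Defensive.

Import Order.TTheory GRing.Theory Num.Theory.
Import numFieldNormedType.Exports.

Local Open Scope classical_set_scope.
Local Open Scope ring_scope.

(* The complex numbers over [R : realType] are [R[i]], with the normed module
   structure of [R[i]] over itself; norms of complex vector spaces take their
   values in the nonnegative elements of [R[i]]. *)
HB.instance Definition _ (R : rcfType) := NormedModule.copy R[i] R[i]^o.

HB.mixin Record NormedModule_isHilbert (R : realType) H
    & CompleteNormedModule R[i] H := {
  hdot : H -> H -> R[i] ;
  hdot_linearl : forall (a : R[i]) (x y z : H),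
    hdot (a *: x + y) z = a * hdot x z + hdot y z ;
  hdot_conj : forall x y : H, hdot y x = (hdot x y)^* ;
  hdot_norm : forall x : H, hdot x x = `|x| ^+ 2
}.

#[short(type="hilbertType")]
HB.structure Definition Hilbert (R : realType) :=
  {H of CompleteNormedModule R[i] H & NormedModule_isHilbert R H}.

Section hdot_dot.
Context (R : realType) (H : hilbertType R).

Let hdot_bilinear : bilinear_for (GRing.Scale.Law.clone _ _ *%R _)
  (GRing.Scale.Law.clone _ _ (Num.conj \; *%R) _) (@hdot R H : H -> H -> R[i]).
Proof.
split=> [z a x y|z a x y] /=; first exact: hdot_linearl.
by rewrite hdot_conj hdot_linearl rmorphD rmorphM/= -!hdot_conj.
Qed.

HB.instance Definition _ := bilinear_isBilinear.Build R[i] H H R[i] _ _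
  (@hdot R H) hdot_bilinear.

Let hdot_hermitian (x y : H) : hdot x y = (-1) ^+ false * (hdot y x)^*.
Proof. by rewrite expr0 mul1r -hdot_conj. Qed.

HB.instance Definition _ := isHermitianSesquilinear.Build R[i] H false
  Num.conj (@hdot R H) hdot_hermitian.

Let hdot_gt0 (x : H) : x != 0 -> 0 < hdot x x.
Proof. by move=> x0; rewrite hdot_norm exprn_gt0// normr_gt0. Qed.

HB.instance Definition _ := isDotProduct.Build R[i] H (@hdot R H) hdot_gt0.

End hdot_dot.

(* An alias of the product type, because [H * K] itself is normed by the
   maximum of the two norms. *)
Definition hsum (R : realType) (H K : hilbertType R) : Type := (H * K)%type.

Section hsum.
Context (R : realType) (H K : hilbertType R).
Local Notation S := (hsum H K).

HB.instance Definition _ := GRing.Lmodule.copy S (H * K)%type.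

Definition hsum_norm (x : S) : R[i] := sqrtC (`|x.1| ^+ 2 + `|x.2| ^+ 2).

Let hsum_norm_sqr (x : S) : hsum_norm x ^+ 2 = `|x.1| ^+ 2 + `|x.2| ^+ 2.
Proof. by rewrite sqrtCK. Qed.

Let hsum_norm_ge0 (x : S) : 0 <= hsum_norm x.
Proof. by rewrite sqrtC_ge0 addr_ge0// exprn_ge0. Qed.

Let hsum_normD (x y : S) : hsum_norm (x + y) <= hsum_norm x + hsum_norm y.
Proof.
rewrite -ler_sqr ?nnegrE ?addr_ge0// sqrrD !hsum_norm_sqr.
set a := `|x.1|; set b := `|x.2|; set c := `|y.1|; set d := `|y.2|.
have a0 : 0 <= a by exact: normr_ge0.
have b0 : 0 <= b by exact: normr_ge0.
have c0 : 0 <= c by exact: normr_ge0.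
have d0 : 0 <= d by exact: normr_ge0.
have ac : `|(x + y).1| ^+ 2 <= (a + c) ^+ 2.
  by rewrite ler_sqr ?nnegrE ?addr_ge0//; exact: (ler_normD x.1 y.1).
have bd : `|(x + y).2| ^+ 2 <= (b + d) ^+ 2.
  by rewrite ler_sqr ?nnegrE ?addr_ge0//; exact: (ler_normD x.2 y.2).
apply: le_trans (lerD ac bd) _.
rewrite !sqrrD.
have cs : a * c + b * d <= hsum_norm x * hsum_norm y.
  rewrite -ler_sqr ?nnegrE ?addr_ge0 ?mulr_ge0//.
  rewrite exprMn !hsum_norm_sqr -subr_ge0.
  rewrite [X in 0 <= X](_ : _ = (a * d - b * c) ^+ 2).
    by rewrite real_exprn_even_ge0// realB// realM// ger0_real.
  by rewrite -/a -/b -/c -/d; ring.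
rewrite [leLHS](_ : _ = a ^+ 2 + b ^+ 2 + (a * c + b * d) *+ 2
  + (c ^+ 2 + d ^+ 2)); last by ring.
by rewrite lerD2r lerD2l lerMn2r cs orbT.
Qed.

Let hsum_normZ (a : R[i]) (x : S) : hsum_norm (a *: x) = `|a| * hsum_norm x.
Proof.
apply/eqP; rewrite -(eqrXn2 (_ : 0 < 2)%N) ?mulr_ge0//.
by rewrite exprMn !hsum_norm_sqr/= !normrZ !exprMn mulrDr.
Qed.

Let hsum_norm0 (x : S) : hsum_norm x = 0 -> x = 0.
Proof.
move=> /(congr1 (fun z => z ^+ 2)); rewrite hsum_norm_sqr expr0n/= => /eqP.
rewrite paddr_eq0 ?exprn_ge0// !expf_eq0/= !normr_eq0 => /andP[/eqP x1 /eqP x2].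
by case: x x1 x2 => ? ? /= -> ->.
Qed.

HB.instance Definition _ := @Lmodule_isNormed.Build R[i] S hsum_norm
  hsum_normD hsum_normZ hsum_norm0.

Let hsum_normE (x : S) : `|x| = hsum_norm x. Proof. by []. Qed.

Let fst_le (x : S) : `|x.1| <= `|x|.
Proof.
by rewrite -ler_sqr ?nnegrE// hsum_normE hsum_norm_sqr lerDl exprn_ge0.
Qed.

Let snd_le (x : S) : `|x.2| <= `|x|.
Proof.
by rewrite -ler_sqr ?nnegrE// hsum_normE hsum_norm_sqr lerDr exprn_ge0.
Qed.

Let le_fst_snd (x : S) : `|x| <= `|x.1| + `|x.2|.
Proof.
rewrite -ler_sqr ?nnegrE ?addr_ge0// hsum_normE hsum_norm_sqr sqrrD.
by rewrite lerD2r lerDl mulrn_wge0// mulr_ge0.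
Qed.

Let hsum_complete (F : set_system S) : ProperFilter F -> cauchy F -> cvg F.
Proof.
move=> FF /cauchy_ballP Fc.
have c1 : cvg (fst @ F).
  apply: cauchy_cvg; apply/cauchy_ballP => e e0.
  rewrite near_map2; apply: filterS (Fc e e0) => -[x y]/=.
  rewrite -!ball_normE/=; exact: le_lt_trans (fst_le (x - y)).
have c2 : cvg (snd @ F).
  apply: cauchy_cvg; apply/cauchy_ballP => e e0.
  rewrite near_map2; apply: filterS (Fc e e0) => -[x y]/=.
  rewrite -!ball_normE/=; exact: le_lt_trans (snd_le (x - y)).
apply/cvg_ex; exists ((lim (fst @ F), lim (snd @ F)) : S).
apply/cvgrPdist_lt => e e0; near=> x.
apply: (le_lt_trans (le_fst_snd _)); rewrite [e]splitr ltrD//=; near: x.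
- by move/cvgrPdist_lt: c1; apply; rewrite divr_gt0.
- by move/cvgrPdist_lt: c2; apply; rewrite divr_gt0.
Unshelve. all: by end_near. Qed.

HB.instance Definition _ := Uniform_isComplete.Build S hsum_complete.

Definition hsum_dot (x y : S) : R[i] := hdot x.1 y.1 + hdot x.2 y.2.

Let hsum_dot_linearl (a : R[i]) (x y z : S) :
  hsum_dot (a *: x + y) z = a * hsum_dot x z + hsum_dot y z.
Proof. by rewrite /hsum_dot/= !hdot_linearl mulrDr addrACA. Qed.

Let hsum_dot_conj (x y : S) : hsum_dot y x = (hsum_dot x y)^*.
Proof. by rewrite /hsum_dot rmorphD/= -!hdot_conj. Qed.

Let hsum_dot_norm (x : S) : hsum_dot x x = `|x| ^+ 2.
Proof. by rewrite /hsum_dot !hdot_norm hsum_normE hsum_norm_sqr. Qed.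

HB.instance Definition _ := @NormedModule_isHilbert.Build R S hsum_dot
  hsum_dot_linearl hsum_dot_conj hsum_dot_norm.

End hsum.

Section bounded_operators.
Context (R : realType) (H : normedModType R[i]).

Definition bounded_linear_op (f : H -> H) : Prop :=
  linear f /\ exists c : R, forall x, `|f x| <= c%:C%C * `|x|.

Definition bop_pred : {pred (H -> H)} := fun f => `[< bounded_linear_op f >].

Record bop := Bop {
  bop_fun :> H -> H ;
  bop_funP : bop_fun \in bop_pred
}.

HB.instance Definition _ := [isSub for bop_fun].
HB.instance Definition _ := [Choice of bop by <:].

Let bop_submod_closed : submod_closed bop_pred.
Proof.
split.
  apply/asboolP; split; first by move=> a x y /=; rewrite scaler0 addr0.
  by exists 0 => x; rewrite mul0r normr0.
move=> a f g /asboolP[fl [c fc]] /asboolP[gl [d gd]]; apply/asboolP; split.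
  move=> b x y; rewrite !fctE fl gl !scalerDr !scalerA (mulrC a b).
  by rewrite addrACA.
exists (complex.Re `|a| * c + d) => x; rewrite !fctE.
have -> : (complex.Re `|a| * c + d)%:C%C = `|a| * c%:C%C + d%:C%C :> R[i].
  by rewrite -[X in X * c%:C%C](RRe_real (normr_real a)) rmorphD rmorphM.
rewrite (le_trans (ler_normD _ _))// mulrDl lerD//.
by rewrite normrZ -mulrA ler_wpM2l.
Qed.

HB.instance Definition _ := GRing.isSubmodClosed.Build R[i] (H -> H) bop_pred
  bop_submod_closed.
HB.instance Definition _ := [SubChoice_isSubLmodule of bop by <:].

Definition opnorm (T : bop) : R[i] :=
  (sup [set complex.Re `|T x| | x in [set x : H | `|x| <= 1]])%:C%C.

Let opnorm_has_sup (T : bop) :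
  has_sup [set complex.Re `|T x| | x in [set x : H | `|x| <= 1]].
Proof.
split; first by exists (complex.Re `|T 0|), 0 => //=; rewrite normr0.
case: T => f /= /asboolP[_ [c fc]]; exists `|c| => _ [x x1 <-].
rewrite -lecR RRe_real ?normr_real//; apply: le_trans (fc x) _.
rewrite (@le_trans _ _ (`|c|%:C%C * `|x|))//.
  by rewrite ler_wpM2r// lecR ler_norm.
by rewrite ler_piMr// (lecR 0).
Qed.

Let bop_linear (T : bop) : linear T.
Proof. by case: T => f /= /asboolP[]. Qed.

Let bopZ (T : bop) (a : R[i]) (x : H) : T (a *: x) = a *: T x.
Proof.
have T0 : T 0 = 0.
  have := bop_linear T 1 0 0; rewrite !scale1r addr0 => e.
  by apply: (addrI (T 0)); rewrite addr0 -e.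
by have := bop_linear T a x 0; rewrite T0 !addr0.
Qed.

Let opnorm_le (T : bop) (x : H) : `|T x| <= opnorm T * `|x|.
Proof.
have [->|x0] := eqVneq x 0.
  by have := bopZ T 0 0; rewrite !scale0r => ->; rewrite !normr0 mulr0.
have nx : 0 < `|x| by rewrite normr_gt0.
rewrite -ler_pdivrMr// mulrC -[X in X * _](ger0_norm _) ?invr_ge0//.
rewrite -normrZ -bopZ -[leLHS](RRe_real (normr_real _)) lecR.
apply: (sup_upper_bound (opnorm_has_sup T)).
exists (`|x|^-1 *: x) => //=.
by rewrite normrZ ger0_norm ?invr_ge0// mulVf// gt_eqF.
Qed.

Let le_opnorm (T : bop) (c : R[i]) : 0 <= c ->
  (forall x, `|T x| <= c * `|x|) -> opnorm T <= c.
Proof.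
move=> c0 Tc; rewrite -[leRHS](RRe_real (ger0_real c0)) lecR.
apply: ge_sup; first by case: (opnorm_has_sup T).
move=> _ [x /= x1 <-]; rewrite -lecR !RRe_real ?normr_real ?ger0_real//.
by apply: le_trans (Tc x) _; rewrite ler_piMr.
Qed.

Let opnorm_ge0 (T : bop) : 0 <= opnorm T.
Proof.
rewrite (lecR 0); apply: (sup_upper_bound (opnorm_has_sup T)).
exists 0; rewrite /= ?normr0//.
by have := bopZ T 0 0; rewrite !scale0r => ->; rewrite normr0.
Qed.

Let opnormD (S T : bop) : opnorm (S + T) <= opnorm S + opnorm T.
Proof.
apply: le_opnorm; first by rewrite addr_ge0.
move=> x; rewrite mulrDl; apply: le_trans (ler_normD (S x) (T x)) _.
by rewrite lerD.
Qed.

Let opnormZ (a : R[i]) (T : bop) : opnorm (a *: T) = `|a| * opnorm T.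
Proof.
apply/eqP; rewrite eq_le; apply/andP; split.
  apply: le_opnorm; first by rewrite mulr_ge0.
  by move=> x; rewrite [X in `|X|](_ : _ = a *: T x)// normrZ -mulrA ler_wpM2l.
have [->|a0] := eqVneq a 0; first by rewrite normr0 mul0r.
have na : 0 < `|a| by rewrite normr_gt0.
rewrite mulrC -ler_pdivlMr//; apply: le_opnorm.
  by rewrite divr_ge0.
move=> x; rewrite mulrAC ler_pdivlMr// mulrC -normrZ.
exact: (opnorm_le (a *: T)).
Qed.

Let opnorm0_eq0 (T : bop) : opnorm T = 0 -> T = 0.
Proof.
move=> T0; apply: val_inj; apply/funext => x /=.
apply/eqP; rewrite -normr_le0.
by have := opnorm_le T x; rewrite T0 mul0r.
Qed.

HB.instance Definition _ := @Lmodule_isNormed.Build R[i] bop opnorm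
  opnormD opnormZ opnorm0_eq0.

Let idop_subproof : (@id H) \in bop_pred.
Proof.
by apply/asboolP; split=> //; exists 1 => x; rewrite mul1r.
Qed.

Definition idop : bop := Bop idop_subproof.

Let compop_subproof (S T : bop) : (S \o T) \in bop_pred.
Proof.
apply/asboolP; split; first by move=> a x y /=; rewrite !bop_linear.
exists (complex.Re (opnorm S * opnorm T)) => x.
rewrite RRe_real ?ger0_real ?mulr_ge0//.
apply: le_trans (opnorm_le _ _) _.
by rewrite -mulrA ler_wpM2l.
Qed.

Definition compop (S T : bop) : bop := Bop (compop_subproof S T).

End bounded_operators.


Definition compact_op (R : realType) (H : normedModType R[i]) (T : bop H) :
    Prop :=
  forall B : set H, bounded_set B -> precompact (T @` B).

(* The set below has exactly one element, by the Riesz representation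
   theorem. *)
Definition adjop (R : realType) (H : hilbertType R) (T : bop H) : bop H :=
  xget 0 [set S : bop H | forall x y, hdot (T x) y = hdot x (S y)].

Definition unitary_op (R : realType) (H : hilbertType R) (T : bop H) : Prop :=
  compop (adjop T) T = idop H /\ compop T (adjop T) = idop H.

Definition selfadjoint_op (R : realType) (H : hilbertType R) (T : bop H) :
    Prop :=
  adjop T = T.

Section subspaces.
Context (R : realType) (X : hilbertType R).
Implicit Types L : set X.

Definition subspace L : Prop :=
  L 0 /\ forall (a : R[i]) x y, L x -> L y -> L (a *: x + y).

Definition closed_subspace L : Prop := subspace L /\ closed L.

Definition orthocompl L : set X := [set x | forall y, L y -> hdot x y = 0].

Definition orthoproj L (x y : X) : Prop := L y /\ orthocompl L (x - y).

Definition finite_dimensional L : Prop :=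
  exists (n : nat) (v : 'I_n -> X),
    forall x, L x -> exists c : 'I_n -> R[i], x = \sum_(i < n) c i *: v i.

Definition infinite_dimensional L : Prop := ~ finite_dimensional L.

Definition direct_sum L1 L2 : Prop :=
  (forall x, exists x1 x2, [/\ L1 x1, L2 x2 & x = x1 + x2]) /\
  L1 `&` L2 = [set 0].

End subspaces.

Definition separable (T : topologicalType) : Prop :=
  exists2 A : set T, countable A & dense A.

(* [op] is only meaningful on [dom]. *)
Record linop (R : realType) (X : hilbertType R) := Linop {
  dom : set X ;
  op :> X -> X ;
  dom_subspace : subspace dom ;
  op_linear : forall (a : R[i]) x y, dom x -> dom y ->
    op (a *: x + y) = a *: op x + op y
}.

Section linop.
Context (R : realType) (X : hilbertType R) (E : linop X).

Definition densely_defined : Prop := dense (dom E).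

Definition closed_op : Prop :=
  closed [set p : X * X | dom E p.1 /\ p.2 = E p.1].

Definition symmetric_op : Prop :=
  forall x y, dom E x -> dom E y -> hdot (E x) y = hdot x (E y).

Definition rng (xi : R[i]) : set X := [set E x - xi *: x | x in dom E].

(* The deficiency indices are the dimensions of the orthogonal complements of
   [rng (- 'i)] and [rng 'i]. *)
Definition infinite_deficiency_indices : Prop :=
  infinite_dimensional (orthocompl (rng 'i)) /\
  infinite_dimensional (orthocompl (rng (- 'i))).

(* [P E] is a restriction of [E P], for [P] the orthogonal projection
   onto [L]. *)
Definition reducing (L : set X) : Prop :=
  closed_subspace L /\
  forall x y, dom E x -> orthoproj L x y -> dom E y /\ orthoproj L (E x) (E y).

(* The restriction of [E] to [L], as an operator in the Hilbert space [L], is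
   densely defined and has the same graph as its adjoint. *)
Definition selfadjoint_on (L : set X) : Prop :=
  L `<=` closure (dom E `&` L) /\
  forall y z, L y -> L z ->
    (forall x, dom E x -> L x -> hdot (E x) y = hdot x z) <->
    (dom E y /\ z = E y).

Definition simple_op : Prop :=
  forall L : set X, reducing L -> selfadjoint_on L -> L = [set 0].

Definition regular (Y : set X) (xi : R[i]) : Prop :=
  closed (rng xi) /\ direct_sum (rng xi) Y.

(* [regproj Y xi] and [regtau Y xi] are the operators $P_Y(\xi)$ and
   $\tau_Y(\xi)$; the choices are unique when [E] is simple and symmetric and
   [xi] is [Y]-regular. *)
Definition regproj (Y : set X) (xi : R[i]) (f : X) : X :=
  xget 0 [set p | Y p /\ rng xi (f - p)].

Definition regtau (Y : set X) (xi : R[i]) (f : X) : X :=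
  xget 0 [set g | dom E g /\ E g - xi *: g = f - regproj Y xi f].

End linop.

(* A function on [Omega] is represented by its extension by zero to [R[i]]. *)
Definition zero_ext (R : realType) (V : lmodType R[i]) (Omega : set R[i])
  (f : R[i] -> V) : R[i] -> V := patch (fun=> 0) Omega f.

(* [fdot] is only meaningful on [fcarrier]. *)
Record funspace (R : realType) (V : lmodType R[i]) := Funspace {
  fcarrier : set (R[i] -> V) ;
  fdot : (R[i] -> V) -> (R[i] -> V) -> R[i]
}.

Section funspaces.
Context (R : realType) (K : hilbertType R) (Omega : set R[i]).
Implicit Types (F : funspace K) (k : R[i] -> R[i] -> bop K) (U : R[i] -> bop K).

Definition analytic (V : normedModType R[i]) (f : R[i] -> V) : Prop :=
  forall z, Omega z -> derivable f z 1.

Record hilbert_funspace F : Prop := {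
  fcarrier_support : forall f, fcarrier F f -> f = zero_ext Omega f ;
  fcarrier0 : fcarrier F 0 ;
  fcarrierP : forall (a : R[i]) f g,
    fcarrier F f -> fcarrier F g -> fcarrier F (a *: f + g) ;
  fdot_linearl : forall (a : R[i]) f g h,
    fcarrier F f -> fcarrier F g -> fcarrier F h ->
    fdot F (a *: f + g) h = a * fdot F f h + fdot F g h ;
  fdot_conj : forall f g, fcarrier F f -> fcarrier F g ->
    fdot F g f = (fdot F f g)^* ;
  fdot_gt0 : forall f, fcarrier F f -> f != 0 -> 0 < fdot F f f ;
  fdot_complete : forall u : nat -> R[i] -> K,
    (forall n, fcarrier F (u n)) ->
    (forall e : R[i], 0 < e ->
      \forall m & n \near \oo, fdot F (u m - u n) (u m - u n) < e) ->
    exists2 f, fcarrier F f &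
      (fun n => fdot F (u n - f) (u n - f)) @ \oo --> (0 : R[i])
}.

(* [k w z] is the value at [z] of the kernel function with pole [w]. *)
Definition positive_kernel k : Prop :=
  forall (n : nat) (w : 'I_n -> R[i]) (u : 'I_n -> K),
    (forall i, Omega (w i)) ->
    0 <= \sum_(i < n) \sum_(j < n) hdot (k (w j) (w i) (u j)) (u i).

Definition reproducing_kernel F k : Prop :=
  forall w (u : K), Omega w ->
    fcarrier F (zero_ext Omega (fun z => k w z u)) /\
    forall f, fcarrier F f ->
      fdot F f (zero_ext Omega (fun z => k w z u)) = hdot (f w) u.

Definition rho (w z : R[i]) : R[i] := - (2 * pi%:C%C * 'i * (z - w^*)).

Definition kernelU (J : bop K) U (w z : R[i]) : bop K :=
  if z == w^* then
    (2 * pi%:C%C * 'i)^-1 *: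
      compop ('D_1 U w^*) (compop J (adjop (U w)))
  else
    (rho w z)^-1 *: (J - compop (U z) (compop J (adjop (U w)))).

Definition J_unitary (J : bop K) U : Prop :=
  forall z, Omega z ->
    compop (U z) (compop J (adjop (U z^*))) = J /\
    compop (adjop (U z^*)) (compop J (U z)) = J.

(* [F] is the space $\mathcal{H}(U)$. *)
Definition HU_space (J : bop K) U F : Prop :=
  [/\ unitary_op J /\ selfadjoint_op J, analytic U, J_unitary J U,
      positive_kernel (kernelU J U) &
      [/\ hilbert_funspace F, forall f, fcarrier F f -> analytic f &
          reproducing_kernel F (kernelU J U)]].

Definition H0U_space (J : bop K) F : Prop :=
  exists2 U, HU_space J U F &
    forall z, Omega z -> ~ compact_op (idop K - U z).

End funspaces.

Section H1.
Context (R : realType) (X : hilbertType R) (E : linop X) (Y : set X)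
  (Omega : set R[i]).

Definition H1_fun (f : X) : R[i] -> hsum X X :=
  zero_ext Omega
    (fun xi => (regproj E Y xi f, (pi%:C%C * 'i)^-1 *: regtau E Y xi f)).

Definition H1_space : funspace (hsum X X) := {|
  fcarrier := range H1_fun ;
  fdot := fun F G => 2 * hdot (xget 0 [set f | H1_fun f = F])
                              (xget 0 [set g | H1_fun g = G])
|}.

End H1.

Section J1.
Context (R : realType) (X : hilbertType R).

Let J1_fun (x : hsum X X) : hsum X X := (x.2, x.1).

Let J1_subproof : J1_fun \in @bop_pred R (hsum X X).
Proof.
apply/asboolP; split=> //; exists 1 => x; rewrite mul1r.
by rewrite /Num.norm/= /hsum_norm addrC.
Qed.

Definition J1 : bop (hsum X X) := Bop J1_subproof.

End J1.

(* Main.v *)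
Require Import Defs.
From HB Require Import structures.
From mathcomp Require Import all_boot all_order all_algebra.
From mathcomp Require Import sesquilinear complex.
From mathcomp Require Import all_classical all_reals all_analysis.
From mathcomp Require Import ring lra.

Set Implicit Arguments.
Unset Strict Implicit.
Unset Printing Implicit Defensive.

Import Order.TTheory GRing.Theory Num.Theory.
Import numFieldNormedType.Exports.

Local Open Scope classical_set_scope.
Local Open Scope ring_scope.

(* Put [F(z) f = (P_Y(z) f, tau_Y(z) f / (pi i))]. The resolvent identity
   [F(l) - F(w) = (l - w) F(l) tau_Y(w)] and the symmetry of [E], in the form
   [F(w)^* J F(conj w) = (tau_Y(conj w) - tau_Y(w)^* ) / (pi i)], show that
   [N(l, w) = J + pi i (l - conj w) F(l) F(w)^*] satisfies
   [N(l, b) J N(conj b, w) = N(l, w)]. Fix [a] in [Omega] with [Im a >= 0].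
   Then [N(a, a) <= J] is invertible with inverse
   [J N(conj a, conj a) J >= J]. Hence [N(a, a)] is negative on the
   [-1]-eigenspace of [J] and positive on the image under [N(a, a)^-1] of the
   [+1]-eigenspace; these subspaces are complementary and [N(a, a)]-orthogonal,
   so normalizing by an inverse square root gives [W] with
   [W^* N(a, a) W = J]. The function [U(z) = s N(z, a) W J], [|s| = 1],
   satisfies [U(l) J U(w)^* = N(l, w)], whence [K^U_w(l) = F(l) F(w)^* / 2],
   which is the reproducing kernel of H1.

   For [y] orthogonal to [Y], [N(z, a)^* (y, 0) = J (y, 0)] does not depend on
   [z]. Since the orthogonal complement of [Y] is infinite dimensional, [I - U]
   for [s = 1] and for [s = -1] cannot both be compact somewhere. *)

(** * Complex normed spaces as real ones *)

(** If [Omega] met the real axis, [a] could be taken real; then [N(a, a) = J] and [W = 1] works. Off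
    the real axis [N(z, a) J] is in general not [J]-unitary. The factor [W] repairs this:
    [W J W^* = J N(conj a, conj a) J], so that [N(l, a) W J W^* N(a, w)] telescopes to [N(l, w)] by
    two uses of the product formula. The sign of [Im a] matters because
    [pi i (a - conj a) = - 2 pi Im a]; this is what puts [N(a, a)] below [J], and the symmetry of
    [Omega] makes the choice possible. Multiplying [U] on the right by a constant [J]-unitary
    operator leaves the kernel unchanged but can affect compactness of [I - U(z)], so the last
    condition is not a property of the kernel. The scalars [1] and [-1] already give enough freedom:
    along one orthonormal sequence the diagonals of [I - U(z1)] for [s = 1] and of [I - U(z)] for
    [s = -1] add up to 2, even for distinct points [z1] and [z]. Hence one failure of the first
    choice validates the second choice at every point. *)

Section realify.
Context (R : realType).

(* The library states Banach's fixed point theorem and the Banach-Steinhaus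
   theorem for normed spaces over a [realType] only. *)
Definition realify (V : normedModType R[i]) : Type := V.

HB.instance Definition _ (V : normedModType R[i]) :=
  GRing.Zmodule.copy (realify V) V.

Section module.
Context (V : normedModType R[i]).
Local Notation W := (realify V).

Definition realify_scale (a : R) (x : W) : W := a%:C%C *: (x : V).

Let scaleA a b (x : W) :
  realify_scale a (realify_scale b x) = realify_scale (a * b) x.
Proof. by rewrite /realify_scale scalerA rmorphM. Qed.

Let scale1 : left_id 1 realify_scale.
Proof. by move=> x; rewrite /realify_scale scale1r. Qed.

Let scaleDr : right_distributive realify_scale +%R.
Proof. by move=> a x y; rewrite /realify_scale scalerDr. Qed.

Let scaleDl (x : W) : {morph realify_scale^~ x : a b / a + b}.
Proof. by move=> a b; rewrite /realify_scale rmorphD scalerDl. Qed.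

HB.instance Definition _ := GRing.Zmodule_isLmodule.Build R W
  scaleA scale1 scaleDr scaleDl.

Definition realify_norm (x : W) : R := complex.Re `|x : V|.

Lemma realify_normE (x : V) : `|x| = (realify_norm x)%:C%C.
Proof. by rewrite RRe_real// normr_real. Qed.

Let normD (x y : W) : realify_norm (x + y) <= realify_norm x + realify_norm y.
Proof. by rewrite -lecR rmorphD/= -!realify_normE; exact: ler_normD. Qed.

Let normZ (a : R) (x : W) : realify_norm (a *: x) = `|a| * realify_norm x.
Proof.
apply: complexI; rewrite rmorphM/= -!realify_normE normrZ; congr (_ * _).
by rewrite normc_def/= expr0n/= addr0 sqrtr_sqr.
Qed.

Let norm0 (x : W) : realify_norm x = 0 -> x = 0.
Proof.
by move=> x0; apply/eqP; rewrite -(@normr_eq0 _ V) realify_normE x0.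
Qed.

HB.instance Definition _ := @Lmodule_isNormed.Build R W realify_norm
  normD normZ norm0.

End module.
End realify.

Section complete.
Context (R : realType).

Let realify_complete (V : completeNormedModType R[i])
  (F : set_system (realify V)) : ProperFilter F -> cauchy F -> cvg F.
Proof.
move=> FF /cauchy_ballP Fc.
have cF : cvg (F : set_system V).
  apply: cauchy_cvg; apply/cauchy_ballP => e e0.
  have eR : e = (complex.Re e)%:C%C by rewrite RRe_real// ger0_real// ltW.
  have e0' : 0 < complex.Re e by rewrite -ltcR -eR.
  apply: filterS (Fc _ e0') => -[x y]/=.
  by rewrite -!ball_normE/= eR realify_normE ltcR.
apply/cvg_ex; exists (lim (F : set_system V)); apply/cvgrPdist_lt => e e0.
have e0' : 0 < e%:C%C by rewrite (ltcR 0).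
move/cvgrPdist_lt : cF => /(_ _ e0'); apply: filterS => x.
by rewrite realify_normE ltcR.
Qed.

HB.instance Definition _ (V : completeNormedModType R[i]) :=
  Uniform_isComplete.Build (realify V) (@realify_complete V).

Lemma cauchy_seq_cvg (V : completeNormedModType R[i]) (u : nat -> V) :
  (forall e : R, 0 < e -> exists N, forall m n, (N <= m)%N -> (N <= n)%N ->
    realify_norm (u m - u n) <= e) -> cvg (u @ \oo).
Proof.
move=> uc; apply: cauchy_cvg; apply/cauchy_ballP => e e0.
have eR : e = (complex.Re e)%:C%C by rewrite RRe_real// ger0_real// ltW.
have e0' : 0 < complex.Re e / 2 by rewrite divr_gt0// -ltcR -eR.
have [N uN] := uc _ e0'; rewrite near_map2; exists ([set n | (N <= n)%N], [set n | (N <= n)%N]).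
  by split; exists N.
move=> -[m n]/= [Nm Nn]; rewrite -ball_normE/= eR realify_normE ltcR.
by apply: le_lt_trans (uN _ _ Nm Nn) _; lra.
Qed.

(** Invariance and contraction are asked on a ball only, because the quadratic map used for square
    roots contracts only near 0. *)
Lemma contraction_fixpoint (V : completeNormedModType R[i]) (f : V -> V)
    (q r : R) : 0 <= q -> q < 1 -> 0 <= r ->
  (forall x, `|x| <= r%:C%C -> `|f x| <= r%:C%C) ->
  (forall x y, `|x| <= r%:C%C -> `|y| <= r%:C%C ->
    `|f x - f y| <= q%:C%C * `|x - y|) ->
  exists2 x, `|x| <= r%:C%C & x = f x.
Proof.
move=> q0 q1 r0 fr fq.
pose U : set (realify V) := [set x | `|x| <= r].
have fU : set_fun U U f.
  by move=> x; rewrite /U/= -!lecR -!realify_normE; exact: fr.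
pose f' : {fun U >-> U} := HB.pack (f : realify V -> realify V)
  (isFun.Build _ _ _ _ _ fU).
have [] := @banach_fixed_point R (realify V) U f'.
- exists (NngNum q0); split => //= -[x y]/= [Ux Uy].
  by rewrite -lecR rmorphM/= -!realify_normE; apply: fq;
    rewrite realify_normE lecR.
- have := @closed_le R r.
  rewrite (_ : U = (fun x : realify V => `|x|) @^-1` [set y | y <= r])//.
  by apply: closed_comp => x _; exact: norm_continuous.
- by exists 0; rewrite /U/= normr0.
- by move=> x Ux fx; exists x => //; rewrite realify_normE lecR.
Qed.

Lemma uniform_boundedness (V : completeNormedModType R[i])
    (W : normedModType R[i]) (F : set (V -> W)) :
  (forall f, F f -> linear f /\ exists c : R, forall x, `|f x| <= c%:C%C * `|x|) ->
  (forall x, exists M : R, forall f, F f -> `|f x| <= M%:C%C) ->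
  exists M : R, forall f, F f -> forall x, `|x| <= 1 -> `|f x| <= M%:C%C.
Proof.
move=> Fb Fp.
have [|x|M FM] := @Banach_Steinhauss R (realify V) (realify W) F _ _ 1.
- move=> f /Fb[fl [c fc]]; split.
    move=> r; exists (`|c| * r) => x xr; rewrite -lecR -realify_normE.
    rewrite (le_trans (fc x))// rmorphM/= realify_normE -!rmorphM lecR.
    by rewrite (@le_trans _ _ (`|c| * realify_norm x))// ?ler_wpM2l//
      ler_wpM2r// ?ler_norm// (normr_ge0 (x : realify V)).
  by move=> a x y; exact: fl.
- have [M FM] := Fp x; exists M => f Ff; rewrite -lecR -realify_normE; exact: FM.
- by exists M => f Ff x x1; rewrite realify_normE lecR; apply: FM => //;
    rewrite -lecR -realify_normE.
Qed.
End complete.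

(** * Hilbert spaces *)

Section hdot_theory.
Context (R : realType) (H : hilbertType R).
Implicit Types (x y z : H) (a : R[i]).

Lemma hdotDl x y z : hdot (x + y) z = hdot x z + hdot y z.
Proof. by have := hdot_linearl 1 x y z; rewrite scale1r mul1r. Qed.

Lemma hdot0l z : hdot 0 z = 0.
Proof. by apply: (addrI (hdot 0 z)); rewrite -hdotDl !addr0. Qed.

Lemma hdotZl a x z : hdot (a *: x) z = a * hdot x z.
Proof. by have := hdot_linearl a x 0 z; rewrite hdot0l !addr0. Qed.

Lemma hdotNl x z : hdot (- x) z = - hdot x z.
Proof. by rewrite -scaleN1r hdotZl mulN1r. Qed.

Lemma hdotBl x y z : hdot (x - y) z = hdot x z - hdot y z.
Proof. by rewrite hdotDl hdotNl. Qed.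

Lemma hdotDr x y z : hdot z (x + y) = hdot z x + hdot z y.
Proof. by rewrite hdot_conj hdotDl rmorphD/= -!hdot_conj. Qed.

Lemma hdot0r z : hdot z 0 = 0.
Proof. by rewrite hdot_conj hdot0l rmorph0. Qed.

Lemma hdotZr a x z : hdot z (a *: x) = a^* * hdot z x.
Proof. by rewrite hdot_conj hdotZl rmorphM/= -!hdot_conj. Qed.

Lemma hdotNr x z : hdot z (- x) = - hdot z x.
Proof. by rewrite hdot_conj hdotNl rmorphN/= -hdot_conj. Qed.

Lemma hdotBr x y z : hdot z (x - y) = hdot z x - hdot z y.
Proof. by rewrite hdotDr hdotNr. Qed.

Lemma hdot_suml (I : Type) (r : seq I) (F : I -> H) z :
  hdot (\sum_(i <- r) F i) z = \sum_(i <- r) hdot (F i) z.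
Proof.
elim: r => [|i r ih]; first by rewrite !big_nil hdot0l.
by rewrite !big_cons hdotDl ih.
Qed.

Lemma hdot_sumr (I : Type) (r : seq I) (F : I -> H) z :
  hdot z (\sum_(i <- r) F i) = \sum_(i <- r) hdot z (F i).
Proof.
elim: r => [|i r ih]; first by rewrite !big_nil hdot0r.
by rewrite !big_cons hdotDr ih.
Qed.

Lemma hdotxx_eq0 x : (hdot x x == 0) = (x == 0).
Proof. by rewrite hdot_norm expf_eq0/= normr_eq0. Qed.

Lemma hdot_ext x y : (forall z, hdot z x = hdot z y) -> x = y.
Proof.
move=> xy; apply/eqP; rewrite -subr_eq0 -hdotxx_eq0 hdotBr.
by rewrite xy subrr.
Qed.

Lemma hdot_extl x y : (forall z, hdot x z = hdot y z) -> x = y.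
Proof. by move=> xy; apply: hdot_ext => z; rewrite hdot_conj xy -hdot_conj. Qed.

Lemma hdot_le x y : `|hdot x y| <= `|x| * `|y|.
Proof.
have [->|y0] := eqVneq y 0; first by rewrite hdot0r !normr0 mulr0.
have ny : 0 < `|y| ^+ 2 by rewrite exprn_gt0 ?normr_gt0.
rewrite -ler_sqr ?nnegrE ?mulr_ge0// exprMn normCK -ler_pdivrMr//.
have := exprn_ge0 2 (normr_ge0 (x - (hdot x y / `|y| ^+ 2) *: y)).
rewrite -hdot_norm !(hdotBl, hdotBr, hdotZl, hdotZr) !hdot_norm.
rewrite rmorphM/= fmorphV/= (conj_Creal (ger0_real (ltW ny))).
rewrite (hdot_conj x y); set b := hdot x y.
set c := b^*; set p := `|x| ^+ 2; move: ny; set n := `|y| ^+ 2 => ny.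
rewrite [X in 0 <= X](_ : _ = p - b * c / n) ?subr_ge0//.
by field; rewrite gt_eqF.
Qed.

End hdot_theory.

Section sequences.
Context (R : realType).

Lemma cvg_hdotl (H : hilbertType R) (u : nat -> H) (l z : H) :
  u @ \oo --> l -> (fun n => hdot (u n) z) @ \oo --> hdot l z.
Proof.
move=> ul; apply/cvgrPdist_lt => e e0.
have z0 : 0 < `|z| + 1 by rewrite ltr_wpDl.
move/cvgrPdist_lt : ul => /(_ (e / (`|z| + 1))).
rewrite divr_gt0// => /(_ isT); apply: filterS => n un.
rewrite -hdotBl (le_lt_trans (hdot_le _ _))//.
rewrite (@le_lt_trans _ _ (`|l - u n| * (`|z| + 1))) ?ler_wpM2l ?lerDl//.
by rewrite -ltr_pdivlMr.
Qed.

Lemma cvg_hdotr (H : hilbertType R) (u : nat -> H) (l z : H) :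
  u @ \oo --> l -> (fun n => hdot z (u n)) @ \oo --> hdot z l.
Proof.
move=> ul; apply/cvgrPdist_lt => e e0.
have := cvg_hdotl (z := z) ul; move/cvgrPdist_lt => /(_ _ e0); apply: filterS => n.
rewrite (hdot_conj (u n)) (hdot_conj l) -rmorphB/=.
by rewrite norm_conjC.
Qed.

End sequences.

Section hsum_theory.
Context (R : realType) (H K : hilbertType R).
Implicit Types x y : hsum H K.

Lemma hsum_hdotE x y : hdot x y = hdot x.1 y.1 + hdot x.2 y.2.
Proof. by []. Qed.

Lemma hsum_norm_sqr x : `|x| ^+ 2 = `|x.1| ^+ 2 + `|x.2| ^+ 2.
Proof. by rewrite -!hdot_norm hsum_hdotE. Qed.

Lemma hsum_fst_le x : `|x.1| <= `|x|.
Proof. by rewrite -ler_sqr ?nnegrE// hsum_norm_sqr lerDl exprn_ge0. Qed.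

Lemma hsum_snd_le x : `|x.2| <= `|x|.
Proof. by rewrite -ler_sqr ?nnegrE// hsum_norm_sqr lerDr exprn_ge0. Qed.

End hsum_theory.

(** * Riesz representation and orthogonal projection *)

Section riesz.
Context (R : realType) (H : hilbertType R).
Implicit Types (x y z : H) (L : set H).

(** Sequences suffice: the limits taken below are those of minimizing sequences and of sequences in
    a graph. *)
Definition seq_closed (T : topologicalType) (L : set T) : Prop :=
  forall (u : nat -> T) l, (forall n, L (u n)) -> u @ \oo --> l -> L l.

Lemma closed_seq_closed (T : topologicalType) (L : set T) :
  closed L -> seq_closed L.
Proof.
move=> Lc u l Lu ul; apply: (closed_cvg L) ul => //.
exact: nearW.
Qed.

Lemma parallelogram x y :
  `|x + y| ^+ 2 + `|x - y| ^+ 2 = 2 * `|x| ^+ 2 + 2 * `|y| ^+ 2.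
Proof.
rewrite -!hdot_norm !(hdotDl, hdotDr, hdotNl, hdotNr); ring.
Qed.

Lemma realify_norm_ge0 (V : normedModType R[i]) (x : V) : 0 <= realify_norm x.
Proof. exact: (normr_ge0 (x : realify V)). Qed.

Lemma ReD (a b : R[i]) : complex.Re (a + b) = complex.Re a + complex.Re b.
Proof. by case: a b => [? ?] [? ?]. Qed.

Lemma ReN (a : R[i]) : complex.Re (- a) = - complex.Re a.
Proof. by case: a. Qed.

Lemma Re_realM (r : R) (a : R[i]) :
  complex.Re (r%:C%C * a) = r * complex.Re a.
Proof. by case: a => a b /=; rewrite mul0r subr0. Qed.

Lemma Re_sqr_norm (V : normedModType R[i]) (x : V) :
  complex.Re (`|x| ^+ 2) = realify_norm x ^+ 2.
Proof. by rewrite realify_normE -rmorphXn/=. Qed.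

(* The representing vector minimizes [`|x|^2 - 2 Re (phi x)] over [L]. *)
Lemma riesz_subspace L (phi : H -> R[i]) (c : R) :
  Defs.subspace L -> seq_closed L -> linear_for *%R phi ->
  (forall x, `|phi x| <= c%:C%C * `|x|) ->
  exists2 z, L z & forall x, L x -> phi x = hdot x z.
Proof.
move=> [L0 LP] Lc phil phic.
have LD x y : L x -> L y -> L (x + y) by move=> Lx /(LP 1 x y Lx); rewrite scale1r.
have LZ a x : L x -> L (a *: x) by move=> Lx; have := LP a x 0 Lx L0; rewrite addr0.
have phiD x y : phi (x + y) = phi x + phi y.
  by have := phil 1 x y; rewrite scale1r mul1r.
have phi0 : phi 0 = 0 by apply: (addrI (phi 0)); rewrite -phiD !addr0.
have phiZ a x : phi (a *: x) = a * phi x.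
  by have := phil a x 0; rewrite phi0 !addr0.
pose nm := @realify_norm R H.
pose G x : R := nm x ^+ 2 - 2 * complex.Re (phi x).
have Re_le (z : R[i]) : complex.Re z <= complex.Re `|z|.
  rewrite (le_trans (ler_norm _))// -lecR; apply: le_trans (normc_ge_Re z) _.
  by rewrite RRe_real// normr_real.
have Glb x : - c ^+ 2 <= G x.
  have : complex.Re (phi x) <= c * nm x.
    rewrite (le_trans (Re_le _))// -lecR RRe_real ?normr_real//.
    by rewrite rmorphM/= -realify_normE.
  have := sqr_ge0 (c - nm x); rewrite /G; set m := nm x; nra.
pose A := [set G x | x in L].
have Ainf : has_inf A.
  split; first by exists (G 0), 0.
  by exists (- c ^+ 2) => _ [x _ <-].
have mle x : L x -> inf A <= G x by move=> Lx; apply: (ge_inf Ainf.2); exists x.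
have /choice[u Hu] : forall n : nat, exists x, L x /\ G x < inf A + n.+1%:R^-1.
  move=> n; have [|_ [x Lx <-] xA] := @inf_adherent R A n.+1%:R^-1 _ Ainf.
    by rewrite invr_gt0.
  by exists x.
have Lu n : L (u n) := (Hu n).1.
(* The parallelogram law, with [G] at the midpoint at least [inf A]; this makes the minimizing
   sequence [u] Cauchy. *)
have mid x y : L x -> L y ->
    nm (x - y) ^+ 2 <= 2 * (G x - inf A) + 2 * (G y - inf A).
  move=> Lx Ly; have := mle _ (LZ (2^-1)%:C%C _ (LD _ _ Lx Ly)).
  have /(congr1 (@complex.Re R)) := parallelogram x y.
  have e2 : (2 : R[i]) = 2%:C%C by rewrite rmorph_nat.
  rewrite e2 !ReD !Re_realM !Re_sqr_norm -/nm /G.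
  have -> : nm ((2^-1)%:C%C *: (x + y)) = 2^-1 * nm (x + y).
    have := normrZ (2^-1 : R) (x + y : realify H).
    by rewrite ger0_norm ?invr_ge0//; apply.
  rewrite phiZ phiD Re_realM ReD.
  move=> h1 h2; nra.
have uc : cvg (u @ \oo).
  apply: cauchy_seq_cvg => e e0.
  have [N] : exists N : nat, 4 * N.+1%:R^-1 <= e ^+ 2.
    exists (Num.truncn (4 / e ^+ 2)).
    rewrite ler_pdivrMr// mulrC -ler_pdivrMr ?exprn_gt0//.
    by rewrite ltW// truncnS_gt.
  move=> Ne; exists N => m n Nm Nn.
  rewrite -(@ler_sqr R) ?nnegrE ?realify_norm_ge0 ?(ltW e0)//.
  apply: le_trans (mid _ _ (Lu m) (Lu n)) _.
  have := (Hu m).2; have := (Hu n).2.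
  move: Ne; set qN : R := N.+1%:R^-1; set qm : R := m.+1%:R^-1.
  set qn : R := n.+1%:R^-1 => Ne.
  have : qm <= qN by rewrite lef_pV2 ?posrE// ler_nat ltnS.
  have : qn <= qN by rewrite lef_pV2 ?posrE// ler_nat ltnS.
  set v := 2%R * inf A; move: (G (u m)) (G (u n)) => a b; lra.
set z := lim (u @ \oo) in uc.
exists z; first exact: Lc Lu uc.
move=> w Lw; apply/eqP; rewrite -subr_eq0; apply/eqP.
set d := phi w - hdot w z.
(* The competitor of [u n] is [u n + t *: w]. Since [s * |w|^2 = 1 - s], the quadratic term in [t]
   stays below the linear one, and a nonzero [d] would push [G] below its infimum. *)
pose s : R := (nm w ^+ 2 + 1)^-1.
pose t : R[i] := s%:C%C * d^*.
have d0 : complex.Re (t * d) = s * complex.Re (`|d| ^+ 2).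
  by rewrite /t -mulrA (mulrC d^*) -normCK Re_realM.
have key n : 0 <= n.+1%:R^-1 + complex.Re (`|t| ^+ 2 * `|w| ^+ 2)
    + 2 * complex.Re (t * (hdot w (u n) - phi w)).
  have := mle _ (LD _ _ (Lu n) (LZ t _ Lw)); have := (Hu n).2.
  rewrite /G /nm -!Re_sqr_norm -!hdot_norm.
  rewrite !(hdotDl, hdotDr, hdotZl, hdotZr) phiD phiZ !ReD mulrBr ReD ReN.
  rewrite (_ : t * (t^* * hdot w w) = `|t| ^+ 2 * hdot w w); last first.
    by rewrite normCK mulrA.
  have -> : complex.Re (t^* * hdot (u n) w) = complex.Re (t * hdot w (u n)).
    rewrite (hdot_conj w) -rmorphM/=; case: (t * _) => a b.
    by rewrite /Num.conj/=.
  by move: (n.+1%:R^-1 : R) => qn; lra.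
(* The limit of [key]: the slack costs [e / 3], the doubled inner product twice as much. *)
have lek : 0 <= complex.Re (`|t| ^+ 2 * `|w| ^+ 2) - 2 * complex.Re (t * d).
  rewrite -subr_ge0 subr0; apply/ler_addgt0Pr => e e0.
  have e3 : 0 < e / 3 by rewrite divr_gt0.
  have e3C : 0 < (e / 3)%:C%C :> R[i] by rewrite (ltcR 0).
  have := cvg_comp _ _ (cvg_hdotr (z := w) uc) (@mulrl_continuous _ t (hdot w z)).
  move=> /cvgrPdist_lt/(_ _ e3C) [N1 _ N1P].
  have [N2 N2P] : exists N : nat, N.+1%:R^-1 <= e / 3.
    exists (Num.truncn ((e / 3)^-1)).
    by rewrite -[leRHS]invrK lef_pV2 ?posrE ?invr_gt0// ltW// truncnS_gt.
  have := key (maxn N1 N2); have := N1P _ (leq_maxl N1 N2); rewrite /=.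
  rewrite distrC -mulrBr => h1.
  have h2 : (maxn N1 N2).+1%:R^-1 <= e / 3.
    by apply: le_trans N2P; rewrite lef_pV2 ?posrE// ler_nat ltnS leq_maxr.
  move: h2; move: (_.+1%:R^-1 : R) => qn h2.
  have : complex.Re (t * (hdot w (u (maxn N1 N2)) - hdot w z)) <= e / 3.
    rewrite (le_trans (Re_le _))// -lecR RRe_real ?normr_real//; exact: ltW.
  rewrite /d !mulrBr !(ReD, ReN); lra.
have D0 : 0 <= complex.Re (`|d| ^+ 2) by rewrite Re_sqr_norm sqr_ge0.
have s0 : 0 < s by rewrite invr_gt0 ltr_wpDl// sqr_ge0.
have sE : s * nm w ^+ 2 = 1 - s.
  by apply/eqP; rewrite -subr_eq opprK -[X in _ + X]mulr1 -mulrDr mulVf// gt_eqF// ltr_wpDl// sqr_ge0.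
have tE : complex.Re (`|t| ^+ 2 * `|w| ^+ 2) = s ^+ 2 * complex.Re (`|d| ^+ 2) * nm w ^+ 2.
  rewrite /t normrM norm_conjC (realify_normE w) (realify_normE d) -/nm.
  rewrite (_ : `|s%:C%C| = s%:C%C) ?ger0_norm ?(lecR 0) ?(ltW s0)//.
  by rewrite -rmorphM -!rmorphXn -rmorphM/=; ring.
move: lek; rewrite tE d0; move: D0; set D := complex.Re (`|d| ^+ 2) => D0 lek.
have : D = 0.
  apply/eqP; rewrite eq_le D0 andbT leNgt; apply/negP => Dgt0.
  have sD : 0 < s * D by rewrite mulr_gt0.
  have ssD : 0 < s * (s * D) by rewrite mulr_gt0.
  have e1 : s ^+ 2 * D * nm w ^+ 2 = s * D * (1 - s) by rewrite -sE; ring.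
  move: lek; rewrite e1 [X in 0 <= X](_ : _ = - (s * D + s * (s * D))); last by ring.
  by rewrite oppr_ge0 leNgt addr_gt0.
by rewrite /D Re_sqr_norm => /eqP; rewrite sqrf_eq0 => /eqP r0; apply/eqP;
  rewrite -normr_eq0 realify_normE r0.
Qed.


Lemma riesz (phi : H -> R[i]) (c : R) : linear_for *%R phi ->
  (forall x, `|phi x| <= c%:C%C * `|x|) -> exists z, forall x, phi x = hdot x z.
Proof.
move=> phil phic; have [//|//|z _ zP] := @riesz_subspace setT phi c _ _ phil phic.
by exists z => x; exact: zP.
Qed.

(** The projection is the vector representing [hdot^~ f] on [L]. *)
Lemma orthoproj_exists L f : Defs.subspace L -> seq_closed L ->
  exists2 y, L y & forall x, L x -> hdot x (f - y) = 0.
Proof.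
move=> sL Lc.
have [||y Ly yP] := @riesz_subspace L (hdot^~ f) (realify_norm f) sL Lc.
- by move=> a x z; rewrite hdotDl hdotZl.
- by move=> x; rewrite -realify_normE mulrC; exact: hdot_le.
- by exists y => // x Lx; rewrite hdotBr yP// subrr.
Qed.

End riesz.

(** * The closed graph theorem on a Hilbert space *)

Section closed_graph.
Context (R : realType) (H : hilbertType R) (T : H -> H).
Hypothesis T_linear : linear T.
Hypothesis T_closed : forall (u : nat -> H) x y,
  u @ \oo --> x -> T \o u @ \oo --> y -> y = T x.

Let TD x y : T (x + y) = T x + T y.
Proof. by have := T_linear 1 x y; rewrite !scale1r. Qed.

Let T0 : T 0 = 0.
Proof. by apply: (addrI (T 0)); rewrite -TD !addr0. Qed.

Let TZ a x : T (a *: x) = a *: T x.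
Proof. by have := T_linear a x 0; rewrite T0 !addr0. Qed.

(** The domain of the adjoint of [T]; the witness [z] is the value of the adjoint at [y]. *)
Let D : set H := [set y | exists z, forall x, hdot (T x) y = hdot x z].

Let D_subspace : Defs.subspace D.
Proof.
split; first by exists 0 => x; rewrite !hdot0r.
move=> a y y' [z zP] [z' zP']; exists (a *: z + z') => x.
by rewrite !(hdotDr, hdotZr) zP zP'.
Qed.

Let fst_cvg (u : nat -> hsum H H) (l : hsum H H) : u @ \oo --> l ->
  (fun n => (u n).1) @ \oo --> l.1 /\ (fun n => (u n).2) @ \oo --> l.2.
Proof.
move=> ul; split; apply/cvgrPdist_lt => e e0;
  move/cvgrPdist_lt : ul => /(_ _ e0); apply: filterS => n; apply: le_lt_trans.
  exact: (hsum_fst_le (l - u n)).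
exact: (hsum_snd_le (l - u n)).
Qed.

(** Projecting [(0, w)] onto the graph of [T] leaves the residual [(- x, w - T x)]. Its
    orthogonality to the graph says that the adjoint of [T] maps [w - T x] to [x]. *)
Let graph_proj (w : H) : exists2 x, D (w - T x) &
  forall x', hdot (T x') (w - T x) = hdot x' x.
Proof.
pose G : set (hsum H H) := [set p | p.2 = T p.1].
have sG : Defs.subspace G.
  split; first by rewrite /G/= T0.
  by move=> a [x1 x2] [y1 y2]; rewrite /G/= => -> ->; rewrite TD TZ.
have cG : seq_closed G.
  move=> u l Gu /fst_cvg[u1 u2]; apply: T_closed u1 _.
  by rewrite (_ : T \o _ = fun n => (u n).2)//; apply/funext => n /=; rewrite Gu.
have [[x y]/= yE yP] := @orthoproj_exists R (hsum H H) G (0, w) sG cG.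
rewrite /G/= in yE; rewrite yE in yP.
have xP x' : hdot (T x') (w - T x) = hdot x' x.
  have := yP (x', T x') erefl; rewrite hsum_hdotE/= sub0r hdotNr.
  by move/eqP; rewrite addrC subr_eq0 => /eqP.
by exists x => //; exists x.
Qed.

(** Pairing [y] with the element [y - T x] of [D] given by [graph_proj] yields
    [|y - T x|^2 + |x|^2 = 0]. *)
Let D_dense (y : H) : (forall z, D z -> hdot y z = 0) -> y = 0.
Proof.
move=> yD; have [x Dx xP] := graph_proj y.
have : hdot (y - T x + T x) (y - T x) = 0 by rewrite subrK yD.
rewrite hdotDl xP => /eqP.
rewrite !hdot_norm paddr_eq0 ?exprn_ge0// !expf_eq0/= !normr_eq0.
by move=> /andP[/eqP + /eqP x0]; rewrite x0 T0 subr0.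
Qed.

(* Uniform boundedness bounds the adjoint of [T] on its domain [D], which is
   then closed, hence all of [H]. *)
Lemma closed_graph : exists c : R, forall x, `|T x| <= c%:C%C * `|x|.
Proof.
pose F : set (H -> R[i]) := [set f | exists y z,
  [/\ `|y| <= 1, forall x, hdot (T x) y = hdot x z & f = hdot^~ z]].
have [||M FM] := @uniform_boundedness R H R[i] F.
- move=> _ [y [z [_ _ ->]]]; split; first by move=> a u v; rewrite hdotDl hdotZl.
  by exists (realify_norm z) => x; rewrite -realify_normE mulrC; exact: hdot_le.
- move=> x; exists (realify_norm (T x)) => _ [y [z [y1 zP ->]]].
  by rewrite -zP (le_trans (hdot_le _ _))// -realify_normE ler_piMr.
(* The functional attached to [y / |y|], evaluated at [z / |z|], has value [|z| / |y|]. *)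
have Mz y z : (forall x, hdot (T x) y = hdot x z) -> `|z| <= M%:C%C * `|y|.
  move=> zP; have [y0|y0] := eqVneq y 0.
    suff -> : z = 0 by rewrite y0 !normr0 mulr0.
    by apply: hdot_ext => x; rewrite -zP y0 !hdot0r.
  have ny : 0 < `|y| by rewrite normr_gt0.
  have [->|z0] := eqVneq z 0.
    rewrite normr0 mulr_ge0//.
    have := FM (hdot^~ 0) _ 0; rewrite hdot0l !normr0; apply => //.
    by exists 0, 0; split => //; [rewrite normr0|move=> x; rewrite !hdot0r].
  have nz : 0 < `|z| by rewrite normr_gt0.
  have := FM (hdot^~ (`|y|^-1 *: z)) _ (`|z|^-1 *: z).
  rewrite !normrZ !normfV !normr_id !mulVf ?gt_eqF//.
  rewrite hdotZl hdotZr hdot_norm conj_Creal ?rpredV ?normr_real//.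
  rewrite expr2 !normrM !normfV !normr_id mulrCA mulKf ?gt_eqF//.
  rewrite mulrC ler_pdivrMr//; apply => //.
  exists (`|y|^-1 *: y), (`|y|^-1 *: z); split => //.
    by rewrite normrZ normfV normr_id mulVf// gt_eqF.
  by move=> x; rewrite !hdotZr zP.
have Dc : seq_closed D.
  move=> u y Du uy; have [v vP] := choice Du.
  have vc : cvg (v @ \oo).
    apply: cauchy_seq_cvg => e e0.
    have e0' : 0 < (e / (`|M| + 1))%:C%C :> R[i].
      by rewrite (ltcR 0) divr_gt0// ltr_wpDl.
    have /cvg_cauchy/cauchy_ballP/(_ _ e0') : cvg (u @ \oo) by apply/cvg_ex; exists y.
    rewrite near_map2 => -[[A B]/= [[N1 _ N1A] [N2 _ N2B]] AB].
    exists (maxn N1 N2) => m n; rewrite !geq_max => /andP[m1 m2] /andP[n1 n2].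
    have := AB (m, n) (conj (N1A _ m1) (N2B _ n2)); rewrite -ball_normE/=.
    rewrite realify_normE ltcR ltr_pdivlMr ?ltr_wpDl// => umn.
    have := Mz (u m - u n) (v m - v n).
    rewrite !realify_normE -rmorphM lecR => h.
    rewrite (le_trans (h _))//; first by move=> x; rewrite !hdotBr vP vP.
    rewrite (le_trans _ (ltW umn))// mulrC ler_wpM2l ?realify_norm_ge0//.
    by rewrite (le_trans (ler_norm _))// lerDl.
  exists (lim (v @ \oo)) => x.
  have h1 := cvg_hdotr (z := T x) uy.
  have h2 := cvg_hdotr (z := x) vc.
  have e : (fun n => hdot (T x) (u n)) = (fun n => hdot x (v n)).
    by apply/funext => n; exact: vP.
  by rewrite e in h1; rewrite -(cvg_lim (@norm_hausdorff _ _) h1) (cvg_lim (@norm_hausdorff _ _) h2).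
have DT y : D y.
  have [z Dz zP] := orthoproj_exists y D_subspace Dc.
  suff /eqP : y - z = 0 by rewrite subr_eq0 => /eqP ->.
  by apply: D_dense => w Dw; rewrite hdot_conj zP// rmorph0.
exists M => x; have [z zP] := DT (T x).
have [->|Tx0] := eqVneq (T x) 0.
  have M0 : 0 <= M%:C%C :> R[i].
    have := FM (hdot^~ 0) _ 0; rewrite hdot0l !normr0; apply => //.
    by exists 0, 0; split => //; [rewrite normr0|move=> x'; rewrite !hdot0r].
  by rewrite normr0 mulr_ge0.
rewrite -(ler_pM2r (_ : 0 < `|T x|)) ?normr_gt0// -expr2 -hdot_norm zP.
rewrite -[leLHS]ger0_norm -?zP ?hdot_norm ?exprn_ge0// -hdot_norm zP.
rewrite (le_trans (hdot_le _ _))// mulrC mulrAC ler_wpM2r//; exact: Mz.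
Qed.

End closed_graph.

(** * Bounded operators and adjoints *)

Section bop_theory.
Context (R : realType) (H : normedModType R[i]).
Implicit Types (S T : bop H) (x y : H) (a : R[i]).

Lemma bop_ext S T : (forall x, S x = T x) -> S = T.
Proof. by move=> ST; apply: val_inj; apply/funext. Qed.

Lemma bop_linearP T : linear T.
Proof. by case: T => f /= /asboolP[]. Qed.

Lemma bopD T x y : T (x + y) = T x + T y.
Proof. by have := bop_linearP T 1 x y; rewrite !scale1r. Qed.

Lemma bop0 T : T 0 = 0.
Proof. by apply: (addrI (T 0)); rewrite -bopD !addr0. Qed.

Lemma bopZ T a x : T (a *: x) = a *: T x.
Proof. by have := bop_linearP T a x 0; rewrite bop0 !addr0. Qed.

Lemma bopN T x : T (- x) = - T x.
Proof. by rewrite -scaleN1r bopZ scaleN1r. Qed.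

Lemma bopB T x y : T (x - y) = T x - T y.
Proof. by rewrite bopD bopN. Qed.

Lemma add_bopE S T x : (S + T) x = S x + T x. Proof. by []. Qed.

Lemma opp_bopE T x : (- T) x = - T x. Proof. by []. Qed.

Lemma scale_bopE a T x : (a *: T) x = a *: T x. Proof. by []. Qed.

Lemma bop_exists (f : H -> H) (c : R) : linear f ->
  (forall x, `|f x| <= c%:C%C * `|x|) -> exists T : bop H, forall x, T x = f x.
Proof.
move=> fl fc.
have fP : f \in @bop_pred R H by apply/asboolP; split=> //; exists c.
by exists (Bop fP).
Qed.

Let opnorm_has_sup T :
  has_sup [set complex.Re `|T x| | x in [set x : H | `|x| <= 1]].
Proof.
split; first by exists (complex.Re `|T 0|), 0 => //=; rewrite normr0.
case: T => f /= /asboolP[_ [c fc]]; exists `|c| => _ [x x1 <-].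
rewrite -lecR RRe_real ?normr_real//; apply: le_trans (fc x) _.
rewrite (@le_trans _ _ (`|c|%:C%C * `|x|))//.
  by rewrite ler_wpM2r// lecR ler_norm.
by rewrite ler_piMr// (lecR 0).
Qed.

Lemma bop_norm_le T x : `|T x| <= `|T| * `|x|.
Proof.
have [->|x0] := eqVneq x 0; first by rewrite bop0 !normr0 mulr0.
have nx : 0 < `|x| by rewrite normr_gt0.
rewrite -ler_pdivrMr// mulrC -[X in X * _](ger0_norm _) ?invr_ge0//.
rewrite -normrZ -bopZ -[leLHS](RRe_real (normr_real _)) lecR.
apply: (sup_upper_bound (opnorm_has_sup T)).
exists (`|x|^-1 *: x) => //=.
by rewrite normrZ ger0_norm ?invr_ge0// mulVf// gt_eqF.
Qed.

Lemma le_bop_norm T (c : R[i]) : 0 <= c ->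
  (forall x, `|T x| <= c * `|x|) -> `|T| <= c.
Proof.
move=> c0 Tc; rewrite -[leRHS](RRe_real (ger0_real c0)) lecR.
apply: ge_sup; first by case: (opnorm_has_sup T).
move=> _ [x /= x1 <-]; rewrite -lecR !RRe_real ?normr_real ?ger0_real//.
by apply: le_trans (Tc x) _; rewrite ler_piMr.
Qed.

Let compA : associative (@compop R H).
Proof. by move=> S T U; apply: bop_ext. Qed.

Let comp1l : left_id (@idop R H) (@compop R H).
Proof. by move=> T; apply: bop_ext. Qed.

Let comp1r : right_id (@idop R H) (@compop R H).
Proof. by move=> T; apply: bop_ext. Qed.

Let compDl : left_distributive (@compop R H) +%R.
Proof. by move=> S T U; apply: bop_ext. Qed.

Let compDr : right_distributive (@compop R H) +%R.
Proof. by move=> S T U; apply: bop_ext => x; exact: (bopD S (T x) (U x)). Qed.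

(** The ring is allowed to be trivial: [1 = 0] when [H] is the zero space. *)
HB.instance Definition _ := GRing.Zmodule_isPzRing.Build (bop H)
  compA comp1l comp1r compDl compDr.

Lemma compopE S T : compop S T = S * T. Proof. by []. Qed.

Lemma idopE : idop H = 1. Proof. by []. Qed.

Lemma mul_bopE S T x : (S * T) x = S (T x). Proof. by []. Qed.

Lemma one_bopE x : (1 : bop H) x = x. Proof. by []. Qed.

Lemma scale_bopAl a S T : a *: (S * T) = (a *: S) * T.
Proof. by apply: bop_ext. Qed.

Lemma scale_bopAr a S T : a *: (S * T) = S * (a *: T).
Proof. by apply: bop_ext => x; rewrite scale_bopE !mul_bopE scale_bopE bopZ. Qed.

Lemma bop_normM S T : `|S * T| <= `|S| * `|T|.
Proof.
apply: le_bop_norm; first by rewrite mulr_ge0.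
move=> x; rewrite mul_bopE (le_trans (bop_norm_le _ _))// -mulrA.
by rewrite ler_wpM2l// bop_norm_le.
Qed.

End bop_theory.

Section bop_complete.
Context (R : realType) (H : completeNormedModType R[i]).

Let bop_complete (F : set_system (bop H)) : ProperFilter F -> cauchy F -> cvg F.
Proof.
move=> FF /cauchy_ballP Fc.
have Fx x : cvg ((fun T : bop H => T x) @ F).
  apply: cauchy_cvg; apply/cauchy_ballP => e e0.
  have x0 : 0 < `|x| + 1 by rewrite ltr_wpDl.
  rewrite near_map2; apply: filterS (Fc (e / (`|x| + 1)) _); last first.
    by rewrite divr_gt0.
  move=> -[S T]/=; rewrite -!ball_normE/= => ST.
  rewrite -opp_bopE -add_bopE (le_lt_trans (bop_norm_le _ _))//.
  rewrite (@le_lt_trans _ _ (`|S - T| * (`|x| + 1))) ?ler_wpM2l ?lerDl//.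
  by rewrite -ltr_pdivlMr.
pose l x := lim ((fun T : bop H => T x) @ F).
(* The Cauchy estimate between [S] and [T] is uniform in [x], so it survives the pointwise limit in
   [S]. *)
have FC e : 0 < e -> \forall T \near F, forall x, `|l x - bop_fun T x| <= e * `|x|.
  move=> e0; have := Fc _ e0 => -[[A B]/= [FA FB] AB].
  near=> T => x.
  have FS : \forall S \near F, `|bop_fun S x - T x| <= e * `|x|.
    apply: filterS FA => S AS.
    have : B T by near: T.
    move=> BT; have := AB (S, T) (conj AS BT); rewrite -ball_normE/= => ST.
    rewrite -opp_bopE -add_bopE (le_trans (bop_norm_le _ _))//.
    by rewrite ler_wpM2r// ltW.
  apply/ler_addgt0Pr => d d0.
  have /cvgrPdist_lt/(_ _ d0) lS := Fx x.
  have [S [/ltW lS1 ST]] := filter_ex (filterI lS FS).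
  by rewrite -(subrKA (S x)) (le_trans (ler_normD _ _))// addrC lerD.
have ll : linear l.
  move=> a x y; apply: (cvg_lim (@norm_hausdorff _ _)).
  rewrite (_ : (fun T : bop H => T (a *: x + y)) = (fun T => a *: T x + T y)).
    by apply: cvgD; [apply: cvgZl_tmp; exact: Fx|exact: Fx].
  by apply/funext => T; rewrite bopD bopZ.
have [T0 lT0] := filter_ex (FC 1 ltr01).
have [L LP] : exists L : bop H, forall x, L x = l x.
  apply: (@bop_exists _ _ l (1 + realify_norm T0)) => // x.
  rewrite -[l x](subrK (T0 x)) (le_trans (ler_normD _ _))// rmorphD rmorph1 mulrDl /=.
  by rewrite lerD// -realify_normE bop_norm_le.
apply/cvg_ex; exists L; apply/cvgrPdist_lt => e e0.
have e2 : 0 < e / 2 by rewrite divr_gt0.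
apply: filterS (FC _ e2) => T lT.
apply: le_lt_trans (_ : e / 2 < e); last by rewrite gtr_pMr// invf_lt1// ltr1n.
by apply: le_bop_norm => [|x]; [exact: ltW|rewrite add_bopE opp_bopE LP].
Unshelve. all: by end_near. Qed.

HB.instance Definition _ := Uniform_isComplete.Build (bop H) bop_complete.

End bop_complete.

Section adjoint.
Context (R : realType) (H : hilbertType R).
Implicit Types (S T : bop H) (x y : H) (a : R[i]).

Lemma bop_norm_real T (x : H) :
  `|T x| <= (realify_norm T)%:C%C * `|x|.
Proof. by rewrite -realify_normE; exact: bop_norm_le. Qed.

(** The set chosen from in [adjop] is inhabited: Riesz gives the value [f u], and testing the
    defining identity at [f u] itself bounds it by [|T| |u|]. *)
Lemma adjopP T x y : hdot (T x) y = hdot x (adjop T y).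
Proof.
suff [S TS] : exists S : bop H, forall x y, hdot (T x) y = hdot x (S y).
  have := @xgetI (bop H) 0 [set S | forall x y, hdot (T x) y = hdot x (S y)] S TS.
  exact.
have ex v : exists z, forall u, hdot (T u) v = hdot u z.
  apply: (@riesz _ _ (fun u => hdot (T u) v) (realify_norm T * realify_norm v)).
    by move=> b u w; rewrite bopD bopZ hdotDl hdotZl.
  move=> u; rewrite (le_trans (hdot_le _ _))// rmorphM/= -!realify_normE.
  by rewrite mulrAC ler_wpM2r// bop_norm_le.
have [f fP] := choice ex.
have fl : linear f.
  move=> b u w; apply: hdot_ext => z.
  by rewrite -fP !(hdotDr, hdotZr) !fP.
have [S SP] : exists S : bop H, forall x, S x = f x.
  apply: (@bop_exists _ _ f (realify_norm T)) => // u.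
  have [->|fu0] := eqVneq (f u) 0.
    by rewrite normr0 mulr_ge0// -realify_normE.
  rewrite -(ler_pM2r (_ : 0 < `|f u|)) ?normr_gt0// -expr2 -hdot_norm -fP.
  rewrite -[leLHS]ger0_norm; last by rewrite fP hdot_norm exprn_ge0.
  by rewrite (le_trans (hdot_le _ _))// mulrAC ler_wpM2r// bop_norm_real.
by exists S => u v; rewrite SP fP.
Qed.

Lemma adjopPr T x y : hdot x (T y) = hdot (adjop T x) y.
Proof. by rewrite hdot_conj adjopP -hdot_conj. Qed.

Lemma adjop_unique S T : (forall x y, hdot (T x) y = hdot x (S y)) ->
  adjop T = S.
Proof.
by move=> TS; apply: bop_ext => y; apply: hdot_ext => x; rewrite -adjopP TS.
Qed.

Lemma adjopK T : adjop (adjop T) = T.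
Proof. by apply: adjop_unique => x y; rewrite -adjopPr. Qed.

Lemma adjopM S T : adjop (S * T) = adjop T * adjop S.
Proof. by apply: adjop_unique => x y; rewrite !mul_bopE !adjopP. Qed.

Lemma adjop1 : adjop (1 : bop H) = 1.
Proof. by apply: adjop_unique. Qed.

Lemma adjopD S T : adjop (S + T) = adjop S + adjop T.
Proof.
by apply: adjop_unique => x y; rewrite !add_bopE hdotDl hdotDr !adjopP.
Qed.

Lemma adjopZ a T : adjop (a *: T) = a^* *: adjop T.
Proof.
by apply: adjop_unique => x y; rewrite !scale_bopE hdotZl hdotZr conjCK !adjopP.
Qed.

Lemma adjopN T : adjop (- T) = - adjop T.
Proof.
by apply: adjop_unique => x y; rewrite !opp_bopE hdotNl hdotNr !adjopP.
Qed.

Lemma adjopB S T : adjop (S - T) = adjop S - adjop T.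
Proof. by rewrite adjopD adjopN. Qed.

Lemma adjop_norm T : `|adjop T| <= `|T|.
Proof.
apply: le_bop_norm => // x; set y := adjop T x.
have [->|y0] := eqVneq y 0; first by rewrite normr0 mulr_ge0.
rewrite -(ler_pM2r (_ : 0 < `|y|)) ?normr_gt0// -expr2 -hdot_norm.
rewrite -[leLHS]ger0_norm; last by rewrite hdot_norm exprn_ge0.
rewrite {1}/y -adjopPr (le_trans (hdot_le _ _))// (mulrC `|T|) -mulrA.
by rewrite ler_wpM2l// bop_norm_le.
Qed.

End adjoint.

(** * Inverse square roots and definite decompositions *)

Section inverse_square_root.
Context (R : realType) (H : hilbertType R).
Implicit Types A B J S T Y Z : bop H.

Lemma contraction_unique (V : normedModType R[i]) (q : R) (x y : V) :
  q < 1 -> `|x - y| <= q%:C%C * `|x - y| -> x = y.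
Proof.
move=> q1; rewrite realify_normE -rmorphM lecR => xy.
apply/eqP; rewrite -subr_eq0 -normr_eq0 realify_normE.
suff -> : realify_norm (x - y) = 0 by [].
have := realify_norm_ge0 (x - y); rewrite le_eqVlt => /predU1P[//|n0].
by move: xy; rewrite leNgt gtr_pMl// q1.
Qed.

(** The inverse is a fixed point of [Z = 1 + Y * Z]. The ball of radius [(1 - r)^-1] is invariant
    because [1 + r (1 - r)^-1 = (1 - r)^-1]. *)
Lemma one_sub_inverse Y (r : R) : 0 <= r -> r < 1 -> `|Y| <= r%:C%C ->
  exists Z, (1 - Y) * Z = 1.
Proof.
move=> r0 r1 Yr.
have r1' : 0 < 1 - r by rewrite subr_gt0.
have [|Z Zr|Z1 Z2 _ _|Z _ ZE] :=
    @contraction_fixpoint R (bop H) (fun Z => 1 + Y * Z) r (1 - r)^-1 r0 r1.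
- by rewrite invr_ge0 ltW.
- rewrite (le_trans (ler_normD _ _))//.
  have -> : (1 - r)^-1 = 1 + r * (1 - r)^-1 by field; rewrite gt_eqF.
  rewrite rmorphD rmorphM/= lerD//.
    by apply: le_bop_norm => // x; rewrite mul1r.
  by rewrite (le_trans (bop_normM _ _))// ler_pM.
- rewrite opprD addrACA subrr add0r -mulrBr (le_trans (bop_normM _ _))//.
  by rewrite ler_wpM2r.
- by exists Z; rewrite mulrBl mul1r {1}ZE addrK.
Qed.

(** The equation means [Y = (B + Y^2) / 2], whose right side contracts by [r] on the ball of radius
    [r], as [|Y^2 - Z^2| <= 2 r |Y - Z|] there. The uniqueness clause is what later transfers
    self-adjointness and commutation from [B] to [Y]. *)
Lemma sqrt_one_sub B (r : R) : 0 <= r -> r < 1 -> `|B| <= r%:C%C ->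
  exists Y, [/\ `|Y| <= r%:C%C, (1 - Y) * (1 - Y) = 1 - B &
    forall Y', `|Y'| <= r%:C%C -> (1 - Y') * (1 - Y') = 1 - B -> Y' = Y].
Proof.
move=> r0 r1 Br.
pose f Y := (2^-1 : R[i]) *: (B + Y * Y).
have r0C : 0 <= r%:C%C :> R[i] by rewrite (lecR 0).
have fB Y : (1 - Y) * (1 - Y) = 1 - B <-> Y = f Y.
  have key : (1 - Y) * (1 - Y) - (1 - B) = (B + Y * Y) - (Y + Y).
    rewrite mulrBl mul1r mulrBr mulr1 !opprB addrC (addrA (B - 1)) subrKA.
    by rewrite addrACA opprD.
  have half Z : Z = 2^-1 *: (B + Z * Z) <-> B + Z * Z = Z + Z.
    have h2 : 2^-1 + 2^-1 = 1 :> R[i] by field.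
    split=> [e|->]; first by rewrite [in RHS]e -scalerDl h2 scale1r.
    by rewrite scalerDr -scalerDl h2 scale1r.
  split=> [e|/half e]; first apply/half; apply/eqP; rewrite -subr_eq0.
    by rewrite -key e subrr.
  by rewrite key e subrr.
have fq Y Z : `|Y| <= r%:C%C -> `|Z| <= r%:C%C ->
    `|f Y - f Z| <= r%:C%C * `|Y - Z|.
  move=> Yr Zr; rewrite /f -scalerBr opprD addrACA subrr add0r normrZ.
  have -> : Y * Y - Z * Z = Y * (Y - Z) + (Y - Z) * Z.
    by rewrite mulrBr mulrBl addrA subrK.
  rewrite normfV normr_nat ler_pdivrMl// mulr_natl mulr2n.
  rewrite (le_trans (ler_normD _ _))// lerD// (le_trans (bop_normM _ _))//.
    by rewrite ler_wpM2r.
  by rewrite mulrC ler_wpM2r.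
have [Y Yr|Y Yr /fB YB] := contraction_fixpoint r0 r1 r0 (f := f) _ fq.
  rewrite /f normrZ normfV normr_nat ler_pdivrMl// mulr_natl mulr2n.
  rewrite (le_trans (ler_normD _ _))// lerD// (le_trans (bop_normM _ _))//.
  rewrite -[leRHS]mulr1 ler_pM// (le_trans Yr)// -(rmorph1 (real_complex R)) lecR.
  exact: ltW.
exists Y; split => // Y' Y'r Y'B; apply: (@contraction_unique _ r _ _ r1).
rewrite {1}((fB _).1 Y'B) {1}((fB _).1 YB); exact: fq.
Qed.

Lemma inverse_sqrt A : adjop A = A -> (forall x, `|x| ^+ 2 <= hdot (A x) x) ->
  exists S, [/\ adjop S = S, S * A * S = 1, S * (S * A) = 1, A * S * S = 1 &
    forall J, adjop J = J -> J * J = 1 -> J * A = A * J -> J * S = S * J].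
Proof.
move=> Asa A1.
(* With [|A x|^2 <= c |x|^2] and [hdot (A x) x >= |x|^2], expanding [|B x|^2] bounds it by
   [(1 - 1/c) |x|^2], hence by [r^2 |x|^2]. So the quadratic form alone controls the norm of [B].
   Since [c] is the square of [a], the root of [A] is [a (1 - Y)]. *)
pose n := realify_norm A; pose a := n + 1; pose c := a ^+ 2.
have n0 : 0 <= n := realify_norm_ge0 A.
have a1 : 1 <= a by rewrite lerDr.
have a0 : 0 < a by rewrite ltr_wpDl.
have c0 : 0 < c by rewrite exprn_gt0.
have c1 : 1 <= c by rewrite exprn_ege1.
pose r := 1 - (2 * c)^-1.
have cV1 : (2 * c)^-1 <= 2^-1 by rewrite lef_pV2 ?posrE ?mulr_gt0// ler_peMr.
have cV0 : 0 < (2 * c)^-1 by rewrite invr_gt0 mulr_gt0.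
have r0 : 0 <= r by rewrite /r; lra.
have r1 : r < 1 by rewrite /r; lra.
pose B := 1 - (c^-1)%:C%C *: A.
have Bsa : adjop B = B.
  by rewrite adjopB adjop1 adjopZ Asa conj_Creal//; apply/complex_realP; exists c^-1.
have Br : `|B| <= r%:C%C.
  apply: le_bop_norm => [|x]; first by rewrite (lecR 0).
  rewrite -ler_sqr ?nnegrE ?mulr_ge0// ?(lecR 0)// exprMn.
  have -> : `|B x| ^+ 2 = `|x| ^+ 2 - 2 * (c^-1)%:C%C * hdot (A x) x
      + (c^-1)%:C%C ^+ 2 * `|A x| ^+ 2.
    rewrite -!hdot_norm add_bopE opp_bopE scale_bopE one_bopE.
    rewrite !(hdotBl, hdotBr, hdotZl, hdotZr) adjopPr Asa.
    rewrite (@conj_Creal _ (c^-1)%:C%C); first by ring.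
    by apply/complex_realP; exists c^-1.
  have hE : hdot (A x) x = (complex.Re (hdot (A x) x))%:C%C.
    by rewrite RRe_real// ger0_real// (le_trans _ (A1 x))// exprn_ge0.
  have := A1 x; rewrite hE; set h := complex.Re _; set P := realify_norm x ^+ 2.
  have PE : `|x| ^+ 2 = P%:C%C by rewrite realify_normE -rmorphXn.
  set Q := realify_norm (A x) ^+ 2.
  have QE : `|A x| ^+ 2 = Q%:C%C by rewrite realify_normE -rmorphXn.
  have QP : Q <= c * P.
    rewrite /Q /P /c -exprMn ler_sqr ?nnegrE ?mulr_ge0 ?realify_norm_ge0 ?(ltW a0)//.
    rewrite -lecR rmorphM/= -!realify_normE (le_trans (bop_norm_le _ _))//.
    by rewrite ler_wpM2r// realify_normE lecR lerDl.
  have -> : 2 = 2%:C%C :> R[i] by rewrite rmorph_nat.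
  rewrite PE QE.
  rewrite -!rmorphXn -!rmorphM -!rmorphB -!rmorphD !lecR /= => ph.
  have P0 : 0 <= P by rewrite sqr_ge0.
  have kc : c^-1 * c = 1 by rewrite mulVf// gt_eqF.
  have rE : r = 1 - c^-1 / 2 by rewrite /r invfM mulrC.
  have k0 : 0 < c^-1 by rewrite invr_gt0.
  rewrite rE; move: kc k0; set k := c^-1 => kc k0.
  have kQ : k ^+ 2 * Q <= k * P.
    rewrite expr2 -mulrA ler_pM2l// -[leRHS]mul1r -kc -mulrA ler_pM2l//.
  have kh : k * P <= k * h by rewrite ler_pM2l.
  have kP : 0 <= k ^+ 2 * P by rewrite mulr_ge0// sqr_ge0.
  rewrite (_ : (1 - k / 2) ^+ 2 * P = P - k * P + k ^+ 2 * P / 4); last by field.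
  by move: (k ^+ 2 * Q) (k ^+ 2 * P) kQ kP => X1 X2 X3 X4; rewrite -mulrA; lra.
have [Y [Yr YB Yu]] := sqrt_one_sub r0 r1 Br.
have [Z TZ] := one_sub_inverse r0 r1 Yr.
have Ysa : adjop Y = Y.
  apply: Yu; first exact: le_trans (adjop_norm Y) Yr.
  by rewrite -Bsa -adjop1 -!adjopB -adjopM YB.
have Zsa : adjop Z = Z.
  have ZT : adjop Z * (1 - Y) = 1.
    by rewrite -{1}Ysa -{1}adjop1 -adjopB -adjopM TZ adjop1.
  by rewrite -[LHS]mulr1 -TZ mulrA ZT mul1r.
have ZT : Z * (1 - Y) = 1.
  by rewrite -{1}Zsa -{1}Ysa -{1}adjop1 -adjopB -adjopM TZ adjop1.
have AE : A = c%:C%C *: ((1 - Y) * (1 - Y)).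
  by rewrite YB /B subKr scalerA -rmorphM/= mulfV ?gt_eqF// scale1r.
pose S := (a^-1)%:C%C *: Z.
have ca : c%:C%C * (a^-1)%:C%C * (a^-1)%:C%C = 1 :> R[i].
  by rewrite -!rmorphM /= /c expr2 !mulfK ?gt_eqF// mulfV ?gt_eqF//.
have sc (k1 k2 k3 : R[i]) (U V W : bop H) : (k1 *: U) * (k2 *: V) * (k3 *: W) =
    (k2 * k1 * k3) *: (U * V * W).
  apply: bop_ext => x; rewrite !(mul_bopE, scale_bopE, bopZ) !scalerA.
  by congr (_ *: _); ring.
exists S; split.
- rewrite adjopZ Zsa conj_Creal//; apply/complex_realP; by exists a^-1.
- by rewrite AE sc ca scale1r !mulrA ZT mul1r TZ.
- rewrite AE mulrA sc [X in X *: _](_ : _ = 1); last by rewrite -[RHS]ca; ring.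
  by rewrite scale1r -mulrA (mulrA Z (1 - Y)) ZT mul1r ZT.
- rewrite AE sc [X in X *: _](_ : _ = 1); last by rewrite -[RHS]ca; ring.
  by rewrite scale1r -!mulrA (mulrA (1 - Y) Z) TZ mul1r TZ.
- move=> J Jsa JJ JA.
  have J1 : `|J| <= 1.
    apply: le_bop_norm => // x; rewrite mul1r -ler_sqr ?nnegrE// -!hdot_norm.
    by rewrite adjopP Jsa -mul_bopE JJ.
  have JB : J * B = B * J.
    by rewrite /B mulrBr mulrBl mulr1 mul1r -scale_bopAr -scale_bopAl JA.
  have JT : J * (1 - Y) * J = 1 - J * Y * J by rewrite mulrBr mulr1 mulrBl JJ.
  (* Conjugation by the symmetry [J] preserves both the ball and the equation, so uniqueness of the
     root applies. *)
  have JY : J * Y * J = Y.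
    apply: Yu.
      rewrite (le_trans (bop_normM _ _))// -[leRHS]mulr1 ler_pM//.
      by rewrite (le_trans (bop_normM _ _))// -[leRHS]mul1r ler_pM.
    rewrite -JT -!mulrA (mulrA J J) JJ mul1r (mulrA (1 - Y)) YB.
    by rewrite mulrA mulrBr mulrBl mulr1 JJ JB -mulrA JJ mulr1.
  have JTc : J * (1 - Y) = (1 - Y) * J.
    have <- : J * (J * ((1 - Y) * J)) = (1 - Y) * J by rewrite mulrA JJ mul1r.
    by congr (_ * _); rewrite mulrA JT JY.
  rewrite -scale_bopAr -scale_bopAl; congr (_ *: _).
  by rewrite -[LHS]mul1r -ZT -!mulrA (mulrA _ J) -JTc -mulrA TZ mulr1.
Qed.

End inverse_square_root.

(** * Congruence of an indefinite operator to a symmetry *)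

Section krein_factorization.
Context (R : realType) (H : hilbertType R).
Variables J N M : bop H.
Hypotheses (J_sa : adjop J = J) (JJ : J * J = 1).
Hypotheses (N_sa : adjop N = N) (M_sa : adjop M = M).
Hypotheses (NM : N * M = 1).
Hypothesis N_le : forall x, hdot (N x) x <= hdot (J x) x.
Hypothesis M_ge : forall x, hdot (J x) x <= hdot (M x) x.

(** [p] and [m] are the orthogonal projections onto the eigenspaces of [J] for [1] and [-1]. *)
Let p : bop H := (2^-1 : R[i]) *: (1 + J).
Let m : bop H := (2^-1 : R[i]) *: (1 - J).

Let h2 : 2^-1 + 2^-1 = 1 :> R[i]. Proof. by field. Qed.

Let half_sa : (2^-1 : R[i])^* = 2^-1.
Proof. by rewrite fmorphV rmorph_nat. Qed.

Let p_sa : adjop p = p. Proof. by rewrite adjopZ adjopD adjop1 J_sa half_sa. Qed.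

Let m_sa : adjop m = m. Proof. by rewrite adjopZ adjopB adjop1 J_sa half_sa. Qed.

Let Jp : J * p = p. Proof. by rewrite -scale_bopAr mulrDr mulr1 JJ addrC. Qed.

Let Jm : J * m = - m.
Proof. by rewrite -scale_bopAr mulrBr mulr1 JJ -opprB scalerN. Qed.

Let pDm : p + m = 1.
Proof. by rewrite -scalerDr addrACA subrr addr0 scalerDr -scalerDl h2 scale1r. Qed.

Let pp : p * p = p.
Proof. by rewrite {1}/p -scale_bopAl mulrDl mul1r Jp scalerDr -scalerDl h2 scale1r. Qed.

Let pm : p * m = 0.
Proof.
apply: (addrI p); rewrite addr0; have : p * (p + m) = p by rewrite pDm mulr1.
by rewrite mulrDr pp.
Qed.

Let mp : m * p = 0.
Proof.
apply: (addrI p); rewrite addr0; have : (p + m) * p = p by rewrite pDm mul1r.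
by rewrite mulrDl pp.
Qed.

Let mm : m * m = m.
Proof. by rewrite -[RHS]mul1r -pDm mulrDl pm add0r. Qed.

(** In the coordinates given by [m + M * p] the form of [N] is block diagonal,
    [p M p + m N m = J A]; the minus sign in [A] turns the negative block positive. *)
Let A := p * M * p - m * N * m.

Let A_sa : adjop A = A.
Proof. by rewrite adjopB !adjopM p_sa m_sa M_sa N_sa !mulrA. Qed.

(** On the range of [p] one has [M >= J = 1], and on the range of [m] one has [- N >= - J = 1]. *)
Let A_ge1 x : `|x| ^+ 2 <= hdot (A x) x.
Proof.
have -> : hdot (A x) x = hdot (M (p x)) (p x) - hdot (N (m x)) (m x).
  by rewrite add_bopE opp_bopE hdotBl !mul_bopE adjopP p_sa [in X in _ - X]adjopP m_sa.
have hp : hdot (p x) (p x) = hdot (p x) x by rewrite adjopPr p_sa -(mul_bopE p p) pp.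
have hm : hdot (m x) (m x) = hdot (m x) x by rewrite adjopPr m_sa -(mul_bopE m m) mm.
have -> : `|x| ^+ 2 = hdot (J (p x)) (p x) - hdot (J (m x)) (m x).
  rewrite -(mul_bopE J p) -(mul_bopE J m) Jp Jm opp_bopE hdotNl opprK hp hm.
  by rewrite -hdotDl -add_bopE pDm hdot_norm.
by rewrite lerB.
Qed.

Let JA : J * A = p * M * p + m * N * m.
Proof. by rewrite mulrBr !mulrA Jp Jm !mulNr opprK. Qed.

Let AJ : A * J = p * M * p + m * N * m.
Proof.
by rewrite -[LHS]adjopK adjopM A_sa J_sa JA adjopD !adjopM p_sa m_sa M_sa N_sa !mulrA.
Qed.

(* [N] is negative on the range of [m], positive on the image under [M] of the
   range of [p], and these are complementary and [N]-orthogonal. *)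
Lemma krein_factorization : exists W : bop H,
  adjop W * N * W = J /\ W * J * adjop W = M.
Proof.
have [S [Ssa SAS SSA ASS SJ]] := inverse_sqrt A_sa A_ge1.
have {}SJ : J * S = S * J by apply: SJ => //; rewrite JA AJ.
(* [G] block-diagonalizes [N] and [S] normalizes the blocks: since [S] commutes with [J], the
   product [S (J A) S] equals [J (S A S) = J]. *)
pose G := m + M * p.
have Gadj : adjop G = m + p * M by rewrite adjopD adjopM m_sa p_sa M_sa.
have WNW : adjop (G * S) * N * (G * S) = J.
  rewrite adjopM Gadj Ssa.
  have -> : S * (m + p * M) * N * (G * S) = S * ((m + p * M) * N * G) * S.
    by rewrite !mulrA.
  have MN : M * N = 1 by rewrite -[LHS]adjopK adjopM N_sa M_sa NM adjop1.
  rewrite mulrDl -(mulrA p) MN mulr1 /G mulrDr !mulrDl pm addr0.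
  rewrite -(mulrA m N (M * p)) (mulrA N M) NM mul1r mp add0r (mulrA p M) addrC.
  by rewrite -JA (mulrA S J) -SJ -!mulrA (mulrA S A) SAS mulr1.
exists (G * S); split => //.
(* The identity for [N] gives [G * S] only a left inverse, so a right inverse is built by hand. [G]
   fixes the range of [m], and [I], the inverse of [A], commutes with [p]. Hence [G] maps [I p] to
   [M I p], whose [p]-part is [p]; subtracting the [m]-part and adding [m] gives [1]. *)
have Sp : p * (S * S) = S * S * p.
  by rewrite -scale_bopAr -scale_bopAl mulrDl mulrDr mul1r mulr1 mulrA SJ -!mulrA SJ.
have Ap : A * p = p * M * p by rewrite mulrBl -!mulrA mp pp !mulr0 subr0.
have [I Ip AI] : exists2 I, p * I = I * p & A * I = 1.
  by exists (S * S) => //; rewrite mulrA.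
have MIp : M * I * p = p * M * p * I + m * M * I * p.
  have -> : p * M * p * I = p * M * I * p by rewrite -!mulrA Ip.
  by rewrite -!mulrDl pDm mul1r.
have GH : G * (I * p + m - m * M * I * p) = 1.
  have Gm (V : bop H) : G * (m * V) = m * V.
    by rewrite mulrA /G mulrDl mm -mulrA pm mulr0 addr0.
  have GIp : G * (I * p) = M * I * p.
    rewrite -Ip mulrA /G mulrDl mp add0r -(mulrA M) pp -mulrA.
    by rewrite Ip mulrA.
  rewrite mulrBr mulrDr GIp -[in X in _ + X - _](mulr1 m) Gm mulr1 -!(mulrA m) Gm.
  by rewrite addrAC {1}MIp !mulrA addrK -Ap -(mulrA A p) Ip mulrA AI mul1r.
have WX : (G * S) * (A * S * (I * p + m - m * M * I * p)) = 1.
  move: GH; move: (I * p + m - _) => V GH.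
  by rewrite -!mulrA (mulrA S A) (mulrA _ S) SAS mul1r GH.
have XW : J * adjop (G * S) * N * (G * S) = 1 by rewrite -!mulrA (mulrA (adjop _)) WNW.
have WX' : (G * S) * (J * adjop (G * S) * N) = 1.
  by rewrite -[X in _ * X]mulr1 -WX (mulrA _ (G * S)) XW mul1r.
by rewrite -[RHS]mul1r -WX' -!mulrA NM mulr1.
Qed.

End krein_factorization.

(** * Orthonormal sequences *)

Section orthonormal_sequences.
Context (R : realType) (H : hilbertType R).
Implicit Types (L : set H) (e : nat -> H).

Definition orthonormal_seq e : Prop := forall i j, hdot (e i) (e j) = (i == j)%:R.

Lemma subspaceD L x y : Defs.subspace L -> L x -> L y -> L (x + y).
Proof. by move=> [_ LP] Lx /(LP 1 x y Lx); rewrite scale1r. Qed.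

Lemma subspaceZ L a x : Defs.subspace L -> L x -> L (a *: x).
Proof. by move=> [L0 LP] Lx; have := LP a x 0 Lx L0; rewrite addr0. Qed.

Lemma subspace_sum L n (f : 'I_n -> H) : Defs.subspace L ->
  (forall i, L (f i)) -> L (\sum_i f i).
Proof.
move=> sL Lf; elim/big_ind : _ => //; first by case: sL.
by move=> x y; exact: subspaceD.
Qed.

(** A Gram-Schmidt step on a vector of [L] outside the span of the [g i]. *)
Lemma orthonormal_extend L n (g : 'I_n -> H) : Defs.subspace L ->
  infinite_dimensional L -> (forall i, L (g i)) ->
  (forall i j, hdot (g i) (g j) = (i == j)%:R) ->
  exists y, [/\ L y, hdot y y = 1 & forall i, hdot y (g i) = 0].
Proof.
move=> sL Linf Lg go.
have [x [Lx xg]] : exists x, L x /\ forall c : 'I_n -> R[i],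
    x <> \sum_(i < n) c i *: g i.
  apply: contrapT => /forallNP nx; apply: Linf; exists n, g => x Lx.
  by apply: contrapT => /forallNP nc; apply: (nx x).
pose y := x - \sum_i hdot x (g i) *: g i.
have y0 : 0 < `|y|.
  rewrite normr_gt0 subr_eq0; apply/eqP; exact: xg.
have Ly : L y.
  apply: subspaceD => //; rewrite -scaleN1r; apply: subspaceZ => //.
  by apply: subspace_sum => // i; exact: subspaceZ.
exists (`|y|^-1 *: y); split.
- exact: subspaceZ.
- rewrite hdotZl hdotZr conj_Creal ?rpredV ?normr_real// hdot_norm.
  by rewrite expr2 mulKf ?gt_eqF// mulVf// gt_eqF.
- move=> i; rewrite hdotZl hdotBl hdot_suml (bigD1 i)//= big1 => [|j ji].
    by rewrite hdotZl go eqxx mulr1 addr0 subrr mulr0.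
  by rewrite hdotZl go (negbTE ji) mulr0.
Qed.

Lemma orthonormal_seq_exists L : Defs.subspace L -> infinite_dimensional L ->
  exists2 e, orthonormal_seq e & forall n, L (e n).
Proof.
move=> sL Linf.
pose P (s : seq H) := (forall i, (i < size s)%N -> L s`_i) /\
  forall i j, (i < size s)%N -> (j < size s)%N -> hdot s`_i s`_j = (i == j)%:R.
have [f fP] : exists f, forall s, P s ->
    [/\ L (f s), hdot (f s) (f s) = 1 & forall i, (i < size s)%N -> hdot (f s) s`_i = 0].
  suff /choice : forall s, exists y, P s -> [/\ L y, hdot y y = 1 &
    forall i, (i < size s)%N -> hdot y s`_i = 0].
    by move=> [f fP]; exists f.
  move=> s.
  have [[Ls so]|nP] := pselect (P s); last by exists 0.
  have [|i j|y [Ly y1 yo]] :=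
      @orthonormal_extend L (size s) (fun i => s`_i) sL Linf.
  - by move=> i; exact: Ls.
  - by rewrite so.
  - by exists y => _; split => // i si; exact: (yo (Ordinal si)).
pose s := fix s n := if n is n'.+1 then rcons (s n') (f (s n')) else [::].
have szs n : size (s n) = n by elim: n => //= n ih; rewrite size_rcons ih.
have Ps n : P (s n).
  elim: n => [|n [Ls so]] /=; first by split.
  have [Lf f1 fo] := fP (s n) (conj Ls so).
  have fo' i : (i < size (s n))%N -> hdot (s n)`_i (f (s n)) = 0.
    by move=> si; rewrite hdot_conj fo// rmorph0.
  split=> [i|i j]; rewrite !size_rcons !ltnS => si.
    by rewrite nth_rcons; case: ltngtP si => // si _; exact: Ls.
  move=> sj; rewrite !nth_rcons.
  case: (ltngtP i) si => // si _; case: (ltngtP j) sj => // sj _.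
  - exact: so.
  - by rewrite fo'// sj ltn_eqF.
  - by rewrite fo// si gtn_eqF.
  - by rewrite f1 si sj eqxx.
(* The lists are nested, so entry [i] is always the vector appended to [s i]. *)
have sE i n : (i < n)%N -> (s n)`_i = f (s i).
  elim: n => // n ih; rewrite ltnS leq_eqVlt => /predU1P[->|i_n] /=.
    by rewrite nth_rcons szs ltnn eqxx.
  by rewrite nth_rcons szs i_n ih.
exists (f \o s) => [i j|n] /=; last by have [] := fP _ (Ps n).
have [_ so] := Ps (maxn i j).+1; have := so i j.
by rewrite szs !ltnS leq_maxl leq_maxr !sE ?ltnS ?leq_maxl ?leq_maxr//; apply.
Qed.

Lemma bessel e n k : orthonormal_seq e ->
  \sum_(i < n) `|hdot k (e i)| ^+ 2 <= `|k| ^+ 2.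
Proof.
move=> eo; pose y := \sum_(i < n) hdot k (e i) *: e i.
have ky : hdot k y = \sum_(i < n) `|hdot k (e i)| ^+ 2.
  by rewrite hdot_sumr; apply: eq_bigr => i _; rewrite hdotZr normCK mulrC.
have yy : hdot y y = \sum_(i < n) `|hdot k (e i)| ^+ 2.
  rewrite {1}/y hdot_suml; apply: eq_bigr => i _.
  rewrite hdotZl hdot_sumr (bigD1 i)//= big1 => [|j ji].
    by rewrite hdotZr eo eqxx mulr1 addr0 normCK.
  by rewrite hdotZr eo val_eqE eq_sym (negbTE ji) mulr0.
have yk : hdot y k = \sum_(i < n) `|hdot k (e i)| ^+ 2.
  rewrite hdot_conj ky conj_Creal//; apply/ger0_real/sumr_ge0 => i _.
  exact: exprn_ge0.
have : 0 <= hdot (k - y) (k - y) by rewrite hdot_norm exprn_ge0.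
by rewrite hdotBl !hdotBr ky yy yk subrr subr0 subr_ge0 hdot_norm.
Qed.

(** By [bessel] the squared moduli are the terms of a convergent series. *)
Lemma orthonormal_weak_cvg0 e k : orthonormal_seq e ->
  (fun n => hdot k (e n)) @ \oo --> (0 : R[i]).
Proof.
move=> eo; pose a (n : nat) : R := realify_norm (hdot k (e n)) ^+ 2.
have a0 n : 0 <= a n by exact: sqr_ge0.
have ac : cvg (series a @ \oo).
  apply: nondecreasing_is_cvgn.
    by apply/nondecreasing_seqP => n; rewrite seriesSr lerDl.
  exists (realify_norm k ^+ 2) => _ [n _ <-].
  have := bessel n k eo; rewrite realify_normE -rmorphXn.
  rewrite -(big_mkord predT (fun i => `|hdot k (e i)| ^+ 2)).
  under eq_bigr do rewrite realify_normE -rmorphXn.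
  by rewrite -rmorph_sum lecR.
have /cvgrPdist_lt al := cvg_series_cvg_0 ac.
apply/cvgrPdist_lt => d d0.
have dR : d = (complex.Re d)%:C%C by rewrite RRe_real// ger0_real// ltW.
have d0' : 0 < complex.Re d by rewrite -ltcR -dR.
apply: filterS (al _ (exprn_gt0 2 d0')) => n.
rewrite !sub0r !normrN ger0_norm// /a dR realify_normE ltcR ltr_sqr ?nnegrE//.
- exact: realify_norm_ge0.
- exact: ltW.
Qed.

(** Clustering the pairs [(C1 (e n), C2 (e n))] in a product of compact sets yields one index [n]
    that serves both operators. *)
Lemma compact_op_cluster (C1 C2 : bop H) e : (forall n, `|e n| <= 1) ->
  compact_op C1 -> compact_op C2 ->
  exists k1 k2, forall (d : R[i]) N, 0 < d -> exists2 n, (N <= n)%N &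
    `|k1 - C1 (e n)| < d /\ `|k2 - C2 (e n)| < d.
Proof.
move=> e1 cC1 cC2.
have eb : bounded_set (range e).
  exists 1; split; first exact: real1.
  by move=> x x1 _ [n _ <-]; rewrite /= (le_trans (e1 n))// ltW.
have := cC1 _ eb; have := cC2 _ eb; rewrite !precompactE => c2 c1.
have cc := compact_setX c1 c2.
pose F := (fun n => (C1 (e n), C2 (e n))) @ \oo.
have [|[k1 k2] [_ kc]] := cc F _.
  by exists 0%N => // n _; split; apply: subset_closure; exists (e n) => //; exists n.
exists k1, k2 => d N d0.
have FN : F ((fun n => (C1 (e n), C2 (e n))) @` [set n | (N <= n)%N]).
  by exists N => // n Nn; exists n.
have [|_ [[n Nn <-]]] := kc _ (ball k1 d `*` ball k2 d) FN.
  by exists (ball k1 d, ball k2 d) => //; split; exact: nbhsx_ballx.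
rewrite -!ball_normE/= => -[h1 h2]; by exists n.
Qed.

(** At a suitable large [n] both [C1 (e n)] and [C2 (e n)] are within [1/4] of fixed vectors, whose
    inner products with [e n] are below [1/4]. Each diagonal entry is then below [1/2], and the two
    cannot add up to 2. *)
Lemma compact_op_sum_neq (C1 C2 : bop H) e : orthonormal_seq e ->
  (forall n, hdot (C1 (e n) + C2 (e n)) (e n) = 2) ->
  compact_op C1 -> ~ compact_op C2.
Proof.
move=> eo C2e cC1 cC2.
have e1 n : `|e n| <= 1.
  by rewrite -ler_sqr ?nnegrE// -hdot_norm eo eqxx expr1n.
have [k1 [k2 kP]] := compact_op_cluster e1 cC1 cC2.
have q0 : 0 < 4^-1 :> R[i] by rewrite invr_gt0.
have /cvgrPdist_lt/(_ _ q0) [N1 _ N1P] := orthonormal_weak_cvg0 k1 eo.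
have /cvgrPdist_lt/(_ _ q0) [N2 _ N2P] := orthonormal_weak_cvg0 k2 eo.
have [n] := kP _ (maxn N1 N2) q0; rewrite geq_max => /andP[n1 n2] [h1 h2].
have := N1P _ n1; have := N2P _ n2; rewrite /= !sub0r !normrN => a2 a1.
have b (k x : H) : `|k - x| < 4^-1 -> `|hdot k (e n)| < 4^-1 ->
    `|hdot x (e n)| < 2^-1.
  move=> kx ke; have -> : x = k - (k - x) by rewrite subKr.
  rewrite hdotBl (le_lt_trans (ler_normB _ _))//.
  rewrite (_ : 2^-1 = 4^-1 + 4^-1); last by field.
  rewrite ltrD// (le_lt_trans (hdot_le _ _))// (le_lt_trans _ kx)//.
  by rewrite -[leRHS]mulr1 ler_wpM2l.
have := ltrD (b _ _ h1 a1) (b _ _ h2 a2).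
move/(le_lt_trans (ler_normD _ _)); rewrite -hdotDl C2e normr_nat.
rewrite (_ : 2^-1 + 2^-1 = 1); last by field.
by move=> h; have : (2%:R < 1%:R :> R[i]) := h; rewrite ltr_nat.
Qed.

(** The rank is at most [n], so the [n + 1] rows are dependent. With [A i j] the inner product of
    vector [i] with member [j] of a spanning family, the combination obtained is orthogonal to the
    span. *)
Lemma exists_combination n (A : 'M[R[i]]_(n.+1, n)) :
  exists2 c : 'I_n.+1 -> R[i], exists i, c i != 0 &
    forall j, \sum_i c i * A i j = 0.
Proof.
have : kermx A != 0.
  rewrite kermx_eq0 /row_free neq_ltn; apply/orP; left.
  by rewrite ltnS rank_leq_col.
case/rowV0Pn => v /sub_kermxP vA v0; exists (v 0).
  apply: contrapT => /forallNP vn; case/eqP : v0; apply/rowP => i.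
  by rewrite mxE; apply/eqP/negPn/negP/vn.
by move=> j; have /rowP/(_ j) := vA; rewrite !mxE.
Qed.

End orthonormal_sequences.

(** * Kernels built from a resolvent-type family *)

Section bop_limits.
Context (R : realType) (H : hilbertType R).

Lemma cvg_bop_mulr (T : Type) (G : set_system T) (FG : Filter G)
    (f : T -> bop H) (l B : bop H) :
  f @ G --> l -> (fun x => f x * B) @ G --> l * B.
Proof.
move=> /cvgrPdist_lt fl; apply/cvgrPdist_lt => e e0.
have B0 : 0 < `|B| + 1 by rewrite ltr_wpDl.
have := fl (e / (`|B| + 1)); rewrite divr_gt0// => /(_ isT).
apply: filterS => x; rewrite ltr_pdivlMr// -mulrBl => fx.
rewrite (le_lt_trans (bop_normM _ _))// (le_lt_trans _ fx)//.
by rewrite ler_wpM2l// lerDl.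
Qed.

Lemma cvg_bop_apply (T : Type) (G : set_system T) (FG : Filter G)
    (f : T -> bop H) (l : bop H) (v : H) :
  f @ G --> l -> (fun x => f x v) @ G --> l v.
Proof.
move=> /cvgrPdist_lt fl; apply/cvgrPdist_lt => e e0.
have v0 : 0 < `|v| + 1 by rewrite ltr_wpDl.
have := fl (e / (`|v| + 1)); rewrite divr_gt0// => /(_ isT).
apply: filterS => x; rewrite ltr_pdivlMr// -opp_bopE -add_bopE => fx.
rewrite (le_lt_trans (bop_norm_le _ _))// (le_lt_trans _ fx)//.
by rewrite ler_wpM2l// lerDl.
Qed.

Lemma cvg_bop (T : Type) (G : set_system T) (FG : Filter G)
    (A : bop H) (u : T -> H) (l : H) :
  u @ G --> l -> (fun x => A (u x)) @ G --> A l.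
Proof.
move=> /cvgrPdist_lt ul; apply/cvgrPdist_lt => e e0.
have A0 : 0 < `|A| + 1 by rewrite ltr_wpDl.
have := ul (e / (`|A| + 1)); rewrite divr_gt0// => /(_ isT).
apply: filterS => x; rewrite ltr_pdivlMr// -bopB => ux.
rewrite (le_lt_trans (bop_norm_le _ _))// (le_lt_trans _ ux)//.
by rewrite mulrC ler_wpM2l// lerDl.
Qed.

End bop_limits.

Section kernel_factorization.
Context (R : realType) (H : hilbertType R) (Omega : set R[i]).
Variables (J : bop H) (F T : R[i] -> bop H).
Hypothesis Omega_open : open Omega.
Hypothesis Omega_conj : forall z, Omega z -> Omega z^*.
Hypotheses (J_sa : adjop J = J) (JJ : J * J = 1).

Local Notation c := (pi%:C%C * 'i : R[i]).

Hypothesis F_resolvent : forall l w, Omega l -> Omega w ->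
  F l - F w = (l - w) *: (F l * T w).
Hypothesis F_deBranges : forall w, Omega w ->
  adjop (F w) * J * F w^* = c^-1 *: (T w^* - adjop (T w)).

Let c_neq0 : c != 0.
Proof.
by rewrite mulf_neq0// ?neq0Ci// -(rmorph0 (real_complex R)) (inj_eq (@complexI R)) gt_eqF// pi_gt0.
Qed.

Let c_conj : c^* = - c.
Proof.
rewrite rmorphM/= conjCi mulrN conj_Creal//; apply/complex_realP.
by exists pi.
Qed.

Let N l w : bop H := J + (c * (l - w^*)) *: (F l * adjop (F w)).

Let N_adj l w : adjop (N l w) = N w l.
Proof.
rewrite adjopD J_sa adjopZ adjopM adjopK; congr (_ + _ *: _).
rewrite rmorphM rmorphB/= conjCK; move: c_conj; set d := _ * _ => ->.
by rewrite mulNr -mulrN opprB.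
Qed.

Let N_conj z : N z z^* = J.
Proof. by rewrite /N conjCK subrr mulr0 scale0r addr0. Qed.

Let N_mul l b w : Omega l -> Omega b -> Omega w ->
  N l b * J * N b^* w = N l w.
Proof.
move=> Ol Ob Ow; have Ob' := Omega_conj Ob.
rewrite /N; set x := c * (l - _); set y := c * (b^* - _).
have -> : c * (l - w^*) = x + y by rewrite /x /y; ring.
set G := adjop (F w).
pose P := F l * G; pose Q := F b^* * G; pose S := F l * adjop (F b).
have e1 : (l - b^*) *: (F l * T b^*) = F l - F b^* by rewrite F_resolvent.
have e2 : (w^* - b^*) *: (adjop (T b) * G) = G - adjop (F b).
  by rewrite -rmorphB/= -adjopM -adjopZ -F_resolvent// adjopB.
(* [F_deBranges] replaces the inner product of three factors by a difference of [T b^*] and the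
   adjoint of [T b]; the resolvent identity collapses each half. The resulting [- Q] and [- S]
   cancel the mixed terms of the product and leave [(x + y) *: P]. *)
have e3 : (x * y) *: (F l * (adjop (F b) * J * F b^*) * G) =
    y *: (P - Q) + x *: (P - S).
  rewrite F_deBranges// -scale_bopAr -scale_bopAl scalerA mulrBr mulrBl scalerBr.
  have -> : x * y * c^-1 = y * (l - b^*).
    by rewrite /x; move: c_neq0; set d := pi%:C%C * _ => d0; field.
  rewrite -scalerA [(l - b^*) *: _]scale_bopAl e1 mulrBl -/P -/Q; congr (_ + _).
  have -> : y * (l - b^*) = - (x * (w^* - b^*)) by rewrite /x /y; ring.
  by rewrite scaleNr opprK -scalerA -mulrA scale_bopAr e2 mulrBr.
have -> : (J + x *: (F l * adjop (F b))) * J * (J + y *: (F b^* * G)) =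
    J + (y *: Q + (x *: S + (x * y) *: (F l * (adjop (F b) * J * F b^*) * G))).
  rewrite mulrDl JJ mulrDl mul1r -addrA; congr (_ + (_ + _)).
  rewrite mulrDr -mulrA JJ mulr1; congr (_ + _).
  by rewrite -!scale_bopAl -scale_bopAr scalerA !mulrA.
have cancel4 (V : zmodType) (q s p1 p2 : V) :
    q + (s + (p1 - q + (p2 - s))) = p2 + p1.
  by rewrite addrACA -opprD (addrA q) addrC subrK addrC.
by rewrite e3 !scalerBr cancel4 scalerDl.
Qed.

(** Local boundedness has to precede continuity, as [F (h + z)] occurs on both sides of the
    resolvent identity; for small [h] its occurrence on the right is absorbed on the left. *)
Let F_norm_le z h : Omega z -> Omega (h + z) -> `|h| * `|T z| <= 2^-1 ->
  `|F (h + z)| <= 2 * `|F z|.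
Proof.
move=> Oz Ohz hT; have := F_resolvent Ohz Oz; rewrite addrK => e.
have : `|F (h + z)| <= `|F z| + 2^-1 * `|F (h + z)|.
  rewrite -{1}(subrK (F z) (F (h + z))) addrC (le_trans (ler_normD _ _))// lerD2l.
  rewrite e normrZ (le_trans (ler_wpM2l _ (bop_normM _ _)))//.
  by rewrite mulrCA mulrC ler_wpM2r.
rewrite -lerBlDr -{1}[`|F (h + z)|]mul1r -mulrBl.
rewrite (_ : 1 - 2^-1 = 2^-1); last by field.
by rewrite ler_pdivrMl.
Qed.

Lemma near_add_open z : Omega z -> \forall h \near 0^', Omega (h + z).
Proof.
move=> Oz; have /nbhs_ballP[e e0 zO] : nbhs z Omega by exact: open_nbhs_nbhs.
apply: filterS (dnbhs0_lt e0) => h he; apply: zO.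
by rewrite -ball_normE/= opprD addrCA subrr addr0 normrN.
Qed.

Lemma resolvent_continuous z : Omega z -> F (h + z) @[h --> 0^'] --> F z.
Proof.
move=> Oz; apply/cvgrPdist_lt => e e0.
have T0 : 0 < 2 * (`|T z| + 1) by rewrite mulr_gt0// ltr_wpDl.
have C0 : 0 < 2 * `|F z| * `|T z| + 1 by rewrite ltr_wpDl// !mulr_ge0.
have T1 : 0 < (2 * (`|T z| + 1))^-1 by rewrite invr_gt0.
have eC : 0 < e / (2 * `|F z| * `|T z| + 1) by rewrite divr_gt0.
near=> h.
have Ohz : Omega (h + z) by near: h; exact: near_add_open.
have hT : `|h| * `|T z| <= 2^-1.
  have : `|h| < (2 * (`|T z| + 1))^-1 by near: h; exact: dnbhs0_lt.
  rewrite invfM ltr_pdivlMr ?ltr_wpDl// => /ltW; apply: le_trans.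
  by rewrite ler_wpM2l// lerDl.
have he : `|h| < e / (2 * `|F z| * `|T z| + 1) by near: h; exact: dnbhs0_lt.
have := F_resolvent Ohz Oz; rewrite addrK distrC => ->.
rewrite normrZ (le_lt_trans (ler_wpM2l _ (bop_normM _ _)))//.
rewrite ltr_pdivlMr// in he; rewrite (le_lt_trans _ he)// ler_wpM2l//.
rewrite (@le_trans _ _ (2 * `|F z| * `|T z|)) ?lerDl//.
by rewrite ler_wpM2r// F_norm_le.
Unshelve. all: by end_near. Qed.

(** [B] is [W * J] for the analyticity of [U], and [1] for the kernel at [z = w^*], where the second
    summand vanishes. *)
Let kernel_quotient (B : bop H) w z : Omega w -> Omega z ->
  h^-1 *: (N (h + z) w * B - N z w * B) @[h --> 0^'] -->
  (c *: F z + (c * (z - w^*)) *: (F z * T z)) * (adjop (F w) * B).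
Proof.
move=> Ow Oz.
have lim1 : (c *: F (h + z) + (c * (z - w^*)) *: (F (h + z) * T z)) *
    (adjop (F w) * B) @[h --> 0^'] -->
    (c *: F z + (c * (z - w^*)) *: (F z * T z)) * (adjop (F w) * B).
  have Fz := resolvent_continuous Oz.
  apply: cvg_bop_mulr; apply: cvgD; apply: cvgZl_tmp => //.
  exact: cvg_bop_mulr.
apply: cvg_trans lim1; apply: near_eq_cvg; near=> h.
have h0 : h != 0 by near: h; exact: nbhs_dnbhs_neq.
have Ohz : Omega (h + z) by near: h; exact: near_add_open.
apply/esym; rewrite -mulrBl (scale_bopAl h^-1) mulrA; congr (_ * _).
rewrite /N opprD addrACA subrr add0r.
have -> : (c * (h + z - w^*)) *: (F (h + z) * adjop (F w)) =
   (c * h) *: (F (h + z) * adjop (F w)) + (c * (z - w^*)) *: (F (h + z) * adjop (F w)).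
  by rewrite -scalerDl -mulrDr addrA.
rewrite -addrA -scalerBr -mulrBl F_resolvent// addrK scalerDr !scalerA.
have hc (a : R[i]) : h^-1 * (a * h) = a by field.
by rewrite hc mulrDl -(scale_bopAl h) scalerA -[_ * h]mulrA hc -!scale_bopAl.
Unshelve. all: by end_near. Qed.

Let N_quad l (x : H) :
  hdot (N l l x) x = hdot (J x) x + c * (l - l^*) * `|adjop (F l) x| ^+ 2.
Proof.
rewrite add_bopE scale_bopE mul_bopE hdotDl hdotZl; congr (_ + _ * _).
by rewrite adjopP hdot_norm.
Qed.

Let c_im l : c * (l - l^*) = (- (2 * pi * complex.Im l))%:C%C.
Proof.
have -> : l - l^* = 2 * (complex.Im l)%:C%C * 'i by rewrite (subcJ l) complexiE.
rewrite (_ : _ * _ = 2 * pi%:C%C * (complex.Im l)%:C%C * ('i ^+ 2)); last by ring.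
by rewrite sqrCi mulrN1 rmorphN !rmorphM/= rmorph_nat.
Qed.

Let middle_factor a : Omega a -> 0 <= complex.Im a -> exists W,
  adjop W * N a a * W = J /\ W * J * adjop W = J * N a^* a^* * J.
Proof.
move=> Oa a0; have Oa' := Omega_conj Oa.
have h0 (r : R) (y : H) : 0 <= r -> 0 <= r%:C%C * `|y| ^+ 2.
  by move=> r0; rewrite mulr_ge0 ?exprn_ge0// (lecR 0).
have r0 : 0 <= 2 * pi * complex.Im a by rewrite !mulr_ge0// pi_ge0.
apply: krein_factorization => //.
- by rewrite !adjopM N_adj J_sa mulrA.
- by rewrite mulrA (mulrA _ J) N_mul// N_conj JJ.
- move=> x; rewrite N_quad c_im rmorphN mulNr gerDl oppr_le0; exact: h0.
- move=> x; rewrite !mul_bopE [leRHS]adjopP J_sa N_quad -(mul_bopE J J) JJ one_bopE.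
  rewrite [hdot x (J x)]adjopPr J_sa -[leLHS]addr0 lerD// conjCK -opprB mulrN c_im -rmorphN.
  by rewrite opprK; exact: h0.
Qed.

Lemma kernel_factorization : Omega !=set0 ->
  exists (a : R[i]) (W : bop H), Omega a /\ forall s : R[i], s * s^* = 1 ->
    let U z := s *: ((J + (c * (z - a^*)) *: (F z * adjop (F a))) * W * J) in
    [/\ analytic Omega U, J_unitary Omega J U & forall w z, Omega w -> Omega z ->
      kernelU J U w z = 2^-1 *: (F z * adjop (F w))].
Proof.
move=> [a0 Oa0].
have [a Oa ima] : exists2 a, Omega a & 0 <= complex.Im a.
  have [?|/ltW im0] := leP 0 (complex.Im a0); first by exists a0.
  exists a0^*; first exact: Omega_conj.
  by move: im0; case: (a0) => x y /=; rewrite oppr_ge0.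
have Oa' := Omega_conj Oa.
have [W [WNW WJW]] := middle_factor Oa ima.
exists a, W; split => // s ss U.
have UE z : U z = s *: (N z a * (W * J)) by rewrite /U mulrA.
have U_adj w : adjop (U w) = s^* *: (J * adjop W * N a w).
  by rewrite UE adjopZ !adjopM N_adj J_sa.
(* The inner factor [W * J * adjop W] is [J * N a^* a^* * J], so [N_mul] applies first with [b = a]
   and then with [b = a^*]. *)
have UJU z w : Omega z -> Omega w -> U z * (J * adjop (U w)) = N z w.
  move=> Oz Ow; rewrite UE U_adj -!scale_bopAr -scale_bopAl scalerA mulrC ss scale1r.
  have -> : N z a * (W * J) * (J * (J * adjop W * N a w)) =
      N z a * (W * (J * J) * J * adjop W) * N a w by rewrite !mulrA.
  by rewrite JJ mulr1 WJW !mulrA N_mul// -{2}(conjCK a) N_mul.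
have U_der z : Omega z -> exists D : bop H,
    h^-1 *: (U (h + z) - U z) @[h --> 0^'] --> D.
  move=> Oz; have [D lim1] : exists D : bop H,
      s *: (h^-1 *: (N (h + z) a * (W * J) - N z a * (W * J))) @[h --> 0^'] --> D.
    by eexists; apply: cvgZl_tmp; exact: (kernel_quotient Oa Oz).
  exists D; apply: cvg_trans lim1; apply: near_eq_cvg; near=> h => /=.
  by rewrite !UE -scalerBr !scalerA mulrC.
have U_analytic : analytic Omega U.
  move=> z Oz; have [D UD] := U_der z Oz; apply/cvg_ex; exists D.
  apply: cvg_trans UD; apply: near_eq_cvg; near=> h.
  by rewrite /= /shift/= -[h%:A]/(h * 1) mulr1.
split => //.
- move=> z Oz; have Oz' := Omega_conj Oz; split.
    by rewrite !compopE UJU// N_conj.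
  (* Here [N_mul] contracts the middle product to [N a a], which [W] carries to [J]. *)
  rewrite !compopE U_adj UE -!scale_bopAr -scale_bopAl scalerA ss scale1r.
  have -> : J * adjop W * N a z^* * (J * (N z a * (W * J))) =
      J * (adjop W * (N a z^* * J * N z a) * W) * J by rewrite !mulrA.
  by rewrite -{2}(conjCK z) N_mul// WNW JJ mul1r.
move=> w z Ow Oz; have Ow' := Omega_conj Ow; rewrite /kernelU; case: eqVneq => [zw|zw].
  rewrite !compopE (_ : 'D_1 U w^* * _ = c *: (F z * adjop (F w))).
    rewrite scalerA; congr (_ *: _); move: c_neq0; rewrite -mulrA.
    by set d := pi%:C%C * _ => d0; field.
  (* By [UJU] the product to compute is the derivative of [N z w] in [z] at [w^*]; only the term
     [c *: F z] survives there, multiplied by the adjoint of [F w]. *)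
  have := @cvg_bop_mulr _ _ _ _ _ _ _ (J * adjop (U w)) (U_analytic _ Ow').
  have := @kernel_quotient 1 _ _ Ow Ow'.
  rewrite subrr mulr0 scale0r addr0 !mulr1 zw scale_bopAl => lim1 lim2.
  apply: etrans (esym (cvg_lim (@norm_hausdorff _ _) (lim2 _))) _.
  apply: (cvg_lim (@norm_hausdorff _ _)).
  apply: cvg_trans lim1; apply: near_eq_cvg; near=> h.
  have Ohz : Omega (h + w^*) by near: h; exact: near_add_open.
  rewrite !mulr1 -scale_bopAl mulrBl -!UJU// /= /shift/=.
  by rewrite -[h%:A]/(h * 1) mulr1.
rewrite !compopE UJU// /N opprD addrA subrr add0r -scaleNr scalerA.
congr (_ *: _); rewrite /rho -(mulrA 2).
have gen (e d : R[i]) : e != 0 -> d != 0 -> (- (2 * e * d))^-1 * - (e * d) = 2^-1.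
  by move=> e0 d0; field; rewrite ?e0 ?d0.
by rewrite gen// subr_eq0.
Unshelve. all: by end_near. Qed.

End kernel_factorization.

(** * Regular points of a symmetric operator *)

Section regular_points.
Context (R : realType) (X : hilbertType R).
Variables (E : linop X) (Y : set X) (Omega : set R[i]).
Hypothesis E_simple : simple_op E.
Hypothesis E_closed : closed_op E.
Hypothesis E_symmetric : symmetric_op E.
Hypothesis Y_closed : closed_subspace Y.
Hypothesis Omega_regular : forall z, Omega z -> regular E Y z.

Lemma linop0 : E 0 = 0.
Proof.
have [d0 _] := dom_subspace E.
have := op_linear 1 d0 d0; rewrite scale1r addr0 scale1r => e.
by apply: (addrI (E 0)); rewrite addr0 -e.
Qed.

Lemma linopZ a x : dom E x -> E (a *: x) = a *: E x.
Proof.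
have [d0 _] := dom_subspace E.
by move=> dx; have := op_linear a dx d0; rewrite linop0 !addr0.
Qed.

Lemma linopD x y : dom E x -> dom E y -> E (x + y) = E x + E y.
Proof. by move=> dx dy; have := op_linear 1 dx dy; rewrite !scale1r. Qed.

Lemma linop_sum n (f : 'I_n -> X) : (forall i, dom E (f i)) ->
  dom E (\sum_i f i) /\ E (\sum_i f i) = \sum_i E (f i).
Proof.
move=> df; apply: (big_ind2 (fun x y => dom E x /\ E x = y)) => //.
- by split; [case: (dom_subspace E)|exact: linop0].
- move=> x1 y1 x2 y2 [d1 e1] [d2 e2]; split.
    exact: (subspaceD (dom_subspace E)).
  by rewrite linopD// e1 e2.
Qed.

Let line_closed (x : X) : x != 0 -> closed_subspace (range (fun a : R[i] => a *: x)).
Proof.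
move=> x0; split.
  split; first by exists 0 => //; rewrite scale0r.
  by move=> a _ _ [b _ <-] [d _ <-]; exists (a * b + d) => //; rewrite scalerDl scalerA.
move=> p pL; exists (hdot p x / hdot x x) => //.
apply/eqP; rewrite eq_sym -subr_eq0 -normr_le0; apply/ler_addgt0Pr => e e0.
rewrite add0r.
have xx0 : hdot x x != 0 by rewrite hdotxx_eq0.
have e2 : 0 < e / 2 by rewrite divr_gt0.
have [_ [[a _ <-] /= pa]] := pL _ (nbhsx_ballx p _ e2).
rewrite -ball_normE/= in pa.
(* The residual of projecting [p] onto the line is also that of [p - a *: x], hence at most twice
   [|p - a *: x|]. *)
have -> : p - hdot p x / hdot x x *: x =
    (p - a *: x) - (hdot (p - a *: x) x / hdot x x) *: x.
  rewrite hdotBl hdotZl mulrBl mulfK// scalerBl opprB addrA subrK //.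
rewrite (le_trans (ler_normB _ _))// (splitr e) lerD ?(ltW pa)//.
apply: le_trans (ltW pa); rewrite normrZ normrM normfV hdot_norm normrX normr_id.
rewrite expr2 invfM !mulrA divfK ?normr_eq0// ler_pdivrMr ?normr_gt0//.
exact: hdot_le.
Qed.

(** An eigenvector of a symmetric operator has a real eigenvalue, and the line it spans reduces [E]
    to a self-adjoint operator, against simplicity. *)
Lemma regular_injective z x : Omega z -> dom E x -> E x = z *: x -> x = 0.
Proof.
move=> Oz dx Ex; apply: contrapT => /eqP x0.
have sym := E_symmetric dx dx.
move: sym; rewrite Ex hdotZl hdotZr => /eqP; rewrite -subr_eq0 -mulrBl mulf_eq0.
rewrite hdotxx_eq0 (negbTE x0) orbF subr_eq0 => /eqP zz.
pose L := range (fun a : R[i] => a *: x).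
have Ldom y : L y -> dom E y /\ E y = z *: y.
  move=> [a _ <-]; split; first exact: (subspaceZ _ (dom_subspace E)).
  by rewrite linopZ// Ex !scalerA mulrC.
suff : L x.
  rewrite (@E_simple L); first by move=> xE; move: x0; rewrite xE eqxx.
  - split; first exact: line_closed.
    move=> u y du [Ly uy]; have [dy Ey] := Ldom _ Ly.
    split => //; split.
      by rewrite Ey; apply: subspaceZ => //; exact: (line_closed x0).1.
    move=> w Lw; have [dw Ew] := Ldom _ Lw.
    by rewrite hdotBl E_symmetric// Ew hdotZr Ey hdotZl -zz -mulrBr -hdotBl uy// mulr0.
  - split.
      by move=> y Ly; apply: subset_closure; split => //; exact: (Ldom _ Ly).1.
    move=> y w Ly Lw; have [dy Ey] := Ldom _ Ly; have [dw Ew] := Ldom _ Lw.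
    split=> [h|[_ ->] u du _]; last exact: E_symmetric.
    split => //; apply/eqP; rewrite -subr_eq0 -hdotxx_eq0.
    have Lv : L (w - E y).
      apply: subspaceD => //; first exact: (line_closed x0).1.
      rewrite Ey -scaleNr; apply: subspaceZ => //; exact: (line_closed x0).1.
    have [dv _] := Ldom _ Lv.
    by rewrite hdotBr -h// E_symmetric// subrr.
by exists 1 => //; rewrite scale1r.
Qed.

Local Notation P := (regproj E Y).
Local Notation tau := (regtau E Y).

(** [regproj] and [regtau] are choices with default 0. Any decomposition exhibited by hand computes
    them: the first by directness of the sum, the second by injectivity of [E - z]. *)
Lemma regular_decomposition_unique z f g p : Omega z -> dom E g -> Y p ->
  f = (E g - z *: g) + p -> P z f = p /\ tau z f = g.
Proof.
move=> Oz dg Yp fE; have [_ [_ RY]] := Omega_regular Oz.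
have sY := Y_closed.1; have dE := dom_subspace E.
have diff g1 g2 : dom E g1 -> dom E g2 ->
    E (g1 - g2) - z *: (g1 - g2) = (E g1 - z *: g1) - (E g2 - z *: g2).
  move=> d1 d2; rewrite linopD//; last by rewrite -scaleN1r; exact: (subspaceZ _ dE).
  rewrite -[- g2]scaleN1r linopZ// !scaleN1r scalerDr scalerN.
  by rewrite !opprD !opprK addrACA.
have Pp : P z f = p.
  apply: xget_unique => [|q [Yq [g' dg' g'E]]].
    by split => //; exists g => //; rewrite fE addrK.
  have : (rng E z `&` Y) (p - q).
    split; last by apply: subspaceD => //; rewrite -scaleN1r; exact: subspaceZ.
    exists (g' - g).
      by apply: subspaceD => //; rewrite -scaleN1r; exact: (subspaceZ _ dE).
    by rewrite diff// g'E fE -(addrA _ p) addrAC subrr add0r.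
  by rewrite RY => /eqP; rewrite subr_eq0 => /eqP.
split => //; apply: xget_unique => [|g' [dg' g'E]].
  by split => //; rewrite Pp fE addrK.
have dgg : dom E (g' - g).
  by apply: subspaceD => //; rewrite -scaleN1r; exact: (subspaceZ _ dE).
apply/eqP; rewrite -subr_eq0; apply/eqP; apply: (@regular_injective z) => //.
by apply/eqP; rewrite -subr_eq0 diff// g'E Pp fE addrK subrr.
Qed.

Lemma regular_decomposition z f : Omega z ->
  [/\ dom E (tau z f), Y (P z f) & f = (E (tau z f) - z *: tau z f) + P z f].
Proof.
move=> Oz; have [_ [/(_ f)[_ [p [[g dg <-] Yp fE]]] _]] := Omega_regular Oz.
by have [-> ->] := regular_decomposition_unique Oz dg Yp fE.
Qed.

Let decomp_linear z a f g : Omega z ->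
  P z (a *: f + g) = a *: P z f + P z g /\
  tau z (a *: f + g) = a *: tau z f + tau z g.
Proof.
move=> Oz; have [df Yf fE] := regular_decomposition f Oz.
have [dg Yg gE] := regular_decomposition g Oz.
apply: regular_decomposition_unique => //.
- by apply: (dom_subspace E).2.
- by apply: Y_closed.1.2.
- rewrite {1}fE {1}gE (op_linear a df dg) scalerDr scalerBr scalerDr opprD.
  by rewrite !scalerA (mulrC z) addrACA; congr (_ + _); rewrite addrACA.
Qed.

(** The graph is closed because both [Y] and the range of [E - z] are. *)
Lemma regproj_bop z : Omega z -> exists A : bop X, forall f, A f = P z f.
Proof.
move=> Oz; have Pl : linear (P z) by move=> a f g; rewrite (decomp_linear _ _ _ Oz).1.
have [|c] := closed_graph Pl; last exact: bop_exists.
move=> u x y ux Puy.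
have Yy : Y y.
  apply: (closed_seq_closed Y_closed.2) Puy => n /=.
  by have [] := regular_decomposition (u n) Oz.
have [cr _] := Omega_regular Oz.
have [g dg gE] : rng E z (x - y).
  apply: (closed_seq_closed cr (u := fun n => u n - P z (u n))).
    move=> n; have [dt _ uE] := regular_decomposition (u n) Oz.
    by exists (tau z (u n)) => //; rewrite {3}uE addrK.
  exact: cvgB.
have [|-> //] := @regular_decomposition_unique z x g y Oz dg Yy _.
by rewrite gE subrK.
Qed.

(** When [u n] and [tau z (u n)] converge, so does [E (tau z (u n)) = u n - P z (u n) + z *: tau z
    (u n)], by boundedness of the projection; closedness of [E] identifies the limit. *)
Lemma regtau_bop z : Omega z -> exists A : bop X, forall f, A f = tau z f.
Proof.
move=> Oz; have tl : linear (tau z) by move=> a f g; rewrite (decomp_linear _ _ _ Oz).2.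
have [|c] := closed_graph tl; last exact: bop_exists.
have [A AP] := regproj_bop Oz.
move=> u x y ux tuy.
have lim1 : (fun n => (tau z (u n), E (tau z (u n)))) @ \oo -->
    (y, x - A x + z *: y).
  apply: cvg_pair => //.
  rewrite (_ : (fun n => E (tau z (u n))) = (fun n => u n - A (u n) + z *: tau z (u n))).
    apply: cvgD; last exact: cvgZl_tmp.
    by apply: cvgB => //; exact: cvg_bop.
  apply/funext => n; have [dt _ uE] := regular_decomposition (u n) Oz.
  by rewrite AP {2}uE addrK subrK.
have [dy yE] : dom E y /\ x - A x + z *: y = E y.
  apply: (closed_seq_closed E_closed) lim1 => n /=.
  by have [] := regular_decomposition (u n) Oz.
have [_ Yx _] := regular_decomposition x Oz.
have [|_ -> //] := @regular_decomposition_unique z x y (P z x) Oz dy Yx _.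
by rewrite -yE addrK AP subrK.
Qed.

End regular_points.

Section J1_theory.
Context (R : realType) (X : hilbertType R).

Lemma J1E (x : hsum X X) : J1 X x = (x.2, x.1). Proof. by []. Qed.

Lemma J1_adj : adjop (J1 X) = J1 X.
Proof. by apply: adjop_unique => x y; rewrite !hsum_hdotE/= addrC. Qed.

Lemma J1_sqr : J1 X * J1 X = 1.
Proof. by apply: bop_ext => -[x1 x2]. Qed.

End J1_theory.

(** * The operator family attached to [E] and its two identities *)

Section model.
Context (R : realType) (X : hilbertType R).
Variables (E : linop X) (Y : set X) (Omega : set R[i]).
Hypothesis E_simple : simple_op E.
Hypothesis E_closed : closed_op E.
Hypothesis E_symmetric : symmetric_op E.
Hypothesis Y_closed : closed_subspace Y.
Hypothesis Omega_conj : forall z, Omega z -> Omega z^*.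
Hypothesis Omega_regular : forall z, Omega z -> regular E Y z.

Local Notation K := (hsum X X).
Local Notation P := (regproj E Y).
Local Notation tau := (regtau E Y).
Local Notation c := (pi%:C%C * 'i : R[i]).

(** A column from [X] to [K], precomposed with the first projection so that it lies in the ring
    [bop K] together with [J1]. *)
Lemma column_bop (A B : bop X) :
  exists T : bop K, forall x, T x = (A x.1, B x.1).
Proof.
apply: (@bop_exists _ _ (fun x : K => (A x.1, B x.1) : K)
  (realify_norm A + realify_norm B)).
  by move=> a x y; rewrite !bop_linearP.
move=> x; have le (y : K) : `|y| <= `|y.1| + `|y.2|.
  rewrite -ler_sqr ?nnegrE ?addr_ge0// hsum_norm_sqr sqrrD.
  by rewrite lerD2r lerDl mulrn_wge0// mulr_ge0.
apply: le_trans (le _) _; rewrite rmorphD/= -!realify_normE mulrDl.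
by rewrite lerD// (le_trans (bop_norm_le _ _))// ler_wpM2l// hsum_fst_le.
Qed.

Lemma model_exists : exists F T : R[i] -> bop K,
  [/\ forall z x, Omega z -> F z x = (P z x.1, c^-1 *: tau z x.1),
      forall l w, Omega l -> Omega w -> F l - F w = (l - w) *: (F l * T w) &
      forall w, Omega w ->
        adjop (F w) * J1 X * F w^* = c^-1 *: (T w^* - adjop (T w))].
Proof.
have Fz z : exists A : bop K, Omega z ->
    forall x, A x = (P z x.1, c^-1 *: tau z x.1).
  have [Oz|] := pselect (Omega z); last by exists 0.
  have [A AP] := regproj_bop E_simple E_symmetric Y_closed Omega_regular Oz.
  have [B BP] := regtau_bop E_simple E_closed E_symmetric Y_closed Omega_regular Oz.
  have [T TP] := column_bop A (c^-1 *: B).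
  by exists T => _ x; rewrite TP AP scale_bopE BP.
have Tz z : exists A : bop K, Omega z -> forall x, A x = (tau z x.1, 0).
  have [Oz|] := pselect (Omega z); last by exists 0.
  have [B BP] := regtau_bop E_simple E_closed E_symmetric Y_closed Omega_regular Oz.
  have [T TP] := column_bop B 0.
  by exists T => _ x; rewrite TP BP.
have [F FE] := choice Fz; have [T TE] := choice Tz.
have dec z f Oz := regular_decomposition E_simple E_symmetric Y_closed Omega_regular (z := z) f Oz.
have uni z f g p Oz := @regular_decomposition_unique _ _ _ _ _ E_simple E_symmetric Y_closed Omega_regular z f g p Oz.
have sE := dom_subspace E.
exists F, T; split => [z x Oz|l w Ol Ow|w Ow].
- by rewrite FE.
- apply: bop_ext => -[f f2]; rewrite scale_bopE mul_bopE add_bopE opp_bopE.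
  rewrite !FE// TE//=.
  have [dg Yg fE] := dec w f Ow; set g := tau w f in dg fE *.
  have [dh Yh gE] := dec l g Ol; set h := tau l g in dh gE *.
  (* Write [f = (E - l) g + (l - w) g + P w f] and decompose the middle [g] at [l]; this yields the
     decomposition of [f] at [l]. *)
  have [|||Pl tl] := uni l f (g + (l - w) *: h) ((l - w) *: P l g + P w f) Ol.
  - by apply: (subspaceD sE) => //; exact: (subspaceZ _ sE).
  - by apply: (subspaceD Y_closed.1) => //; exact: (subspaceZ _ Y_closed.1).
  - rewrite linopD//; last exact: (subspaceZ _ sE).
    have kg : (l - w) *: g =
        (l - w) *: E h - l *: ((l - w) *: h) + (l - w) *: P l g.
      by rewrite {1}gE scalerDr scalerBr !scalerA (mulrC (l - w)).
    have wg : w *: g = l *: g - (l - w) *: g by rewrite -scalerBl subKr.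
    rewrite linopZ// scalerDr opprD {1}fE wg kg opprB !addrA; congr (_ + _).
    by rewrite [LHS]addrAC; congr (_ + _); exact: addrAC.
  rewrite Pl tl; congr (_, _).
    by rewrite addrK.
  by rewrite scalerDr addrAC subrr add0r !scalerA mulrC.
- apply: bop_ext => x; apply: hdot_extl => y.
  rewrite -mulrA !mul_bopE hdot_conj adjopPr adjopK -hdot_conj.
  rewrite scale_bopE hdotZl add_bopE opp_bopE hdotBl -[in X in _ - X]adjopPr.
  rewrite J1E !hsum_hdotE !FE ?TE//; last exact: Omega_conj.
  rewrite /= hdot0r hdot0l !addr0.
  have k_conj : (c^-1)^* = - c^-1.
    rewrite fmorphV rmorphM/= conjCi mulrN invrN conj_Creal//.
    by apply/complex_realP; exists pi.
  rewrite hdotZl hdotZr k_conj mulNr -mulrBr; congr (_ * _).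
  (* Substituting the decompositions of [f] at [w^*] and of [g] at [w], the terms in [hdot t' t]
     cancel, and what remains is the symmetry of [E] on [t'] and [t]. *)
  have [df _ fE] := dec _ x.1 (Omega_conj Ow); have [dg _ gE] := dec _ y.1 Ow.
  move: df dg fE gE; set f := x.1; set g := y.1; set t' := tau _ f; set t := tau _ g.
  set p' := P _ f; set p := P _ g => df dg -> ->.
  rewrite !(hdotDl, hdotDr, hdotNl, hdotNr, hdotZl, hdotZr) E_symmetric//.
  by ring.
by exact: Omega_conj.
Qed.

End model.

(** * The space H1 *)

Section infinite_codimension.
Context (R : realType) (X : hilbertType R).

(** A point [x] of [D] closer to [h] than [|h|] would give [|h|^2 = hdot h (h - x) < |h|^2]. *)
Lemma dense_orthocompl0 (D : set X) h : dense D ->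
  (forall x, D x -> hdot h x = 0) -> h = 0.
Proof.
move=> Dd hD; apply: contrapT => /eqP h0.
have nh : 0 < `|h| by rewrite normr_gt0.
have [||x [hx Dx]] := Dd (ball h `|h|).
- by exists h; exact: ballxx.
- exact: ball_open.
rewrite -ball_normE/= in hx.
have : `|h| ^+ 2 <= `|h| * `|h - x|.
  rewrite -hdot_norm -[leLHS]ger0_norm; last by rewrite hdot_norm exprn_ge0.
  have -> : hdot h h = hdot h (h - x) by rewrite hdotBr (hD x)// subr0.
  exact: hdot_le.
by rewrite expr2 ler_pM2l// => /le_lt_trans/(_ hx); rewrite ltxx.
Qed.

Lemma orthocompl_subspace (L : set X) : Defs.subspace (orthocompl L).
Proof.
split; first by move=> y _; rewrite hdot0l.
by move=> a x y Lx Ly z Lz; rewrite hdotDl hdotZl Lx// Ly// mulr0 addr0.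
Qed.

(** If [n] vectors spanned [D], some nonzero combination of [n + 1] orthonormal vectors would be
    orthogonal to [D]. *)
Lemma dense_infinite_dimensional (D : set X) : dense D ->
  infinite_dimensional [set: X] -> infinite_dimensional D.
Proof.
move=> Dd Xinf [n [v Dv]].
have [e eo _] := @orthonormal_seq_exists R X setT (conj I (fun _ _ _ _ _ => I)) Xinf.
have [c [i ci0] cA] := exists_combination
  (\matrix_(i < n.+1, j < n) hdot (e i) (v j)).
pose h := \sum_i c i *: e i.
have h0 : h = 0.
  apply: (dense_orthocompl0 Dd) => x /Dv[d ->].
  rewrite hdot_sumr big1// => j _; rewrite hdotZr /h hdot_suml.
  have := cA j; under eq_bigr do rewrite mxE.
  by under [in X in _ -> X]eq_bigr do rewrite hdotZl; move=> ->; rewrite mulr0.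
case/eqP : ci0; have := hdot0l (e i); rewrite -h0 /h hdot_suml (bigD1 i)//= big1.
  by rewrite hdotZl eo eqxx mulr1 addr0.
by move=> j ji; rewrite hdotZl eo val_eqE (negbTE ji) mulr0.
Qed.

(** If [n] vectors spanned the complement of [Y], some nonzero combination [h] of [n + 1]
    orthonormal vectors of the domain would make [E h - z *: h] orthogonal to that complement, hence
    an element of [Y]. Directness of the sum and injectivity of [E - z] then force [h = 0]. *)
Lemma orthocompl_infinite (E : linop X) (Y : set X) z :
  infinite_dimensional [set: X] -> densely_defined E -> closed_subspace Y ->
  rng E z `&` Y = [set 0] -> (forall x, dom E x -> E x = z *: x -> x = 0) ->
  infinite_dimensional (orthocompl Y).
Proof.
move=> Xinf Ed [sY cY] RY Einj [n [v vY]].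
have Dinf := dense_infinite_dimensional Ed Xinf.
have sE := dom_subspace E.
have [g go gE] := orthonormal_seq_exists sE Dinf.
have [c [i ci0] cA] := exists_combination
  (\matrix_(i < n.+1, j < n) hdot (E (g i) - z *: g i) (v j)).
pose h := \sum_i c i *: g i.
have dcg (j : 'I_n.+1) : dom E (c j *: g j) by exact: (subspaceZ _ sE).
have [dh Eh] := linop_sum dcg.
have EhE : E h - z *: h = \sum_i c i *: (E (g i) - z *: g i).
  rewrite Eh scaler_sumr -sumrB; apply: eq_bigr => j _.
  by rewrite linopZ// scalerBr !scalerA mulrC.
have h0 : h = 0.
  apply: Einj => //; apply/eqP; rewrite -subr_eq0; apply/eqP.
  have : (rng E z `&` Y) (E h - z *: h).
    split; first by exists h.
    have [y Yy yP] := orthoproj_exists (E h - z *: h) sY (closed_seq_closed cY).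
    suff /eqP : E h - z *: h - y = 0 by rewrite subr_eq0 => /eqP ->.
    set q := _ - y; apply/eqP; rewrite -hdotxx_eq0; apply/eqP.
    have qY : orthocompl Y q by move=> x Yx; rewrite hdot_conj yP// rmorph0.
    rewrite {1}/q hdotBl (yP y Yy) subr0.
    have [d ->] := vY _ qY; rewrite EhE hdot_sumr big1// => j _.
    rewrite hdotZr hdot_suml.
    have := cA j; under eq_bigr do rewrite mxE.
    by under [in X in _ -> X]eq_bigr do rewrite hdotZl; move=> ->; rewrite mulr0.
  by rewrite RY.
case/eqP : ci0; have := hdot0l (g i); rewrite -h0 /h hdot_suml (bigD1 i)//= big1.
  by rewrite hdotZl go eqxx mulr1 addr0.
by move=> j ji; rewrite hdotZl go val_eqE (negbTE ji) mulr0.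
Qed.

End infinite_codimension.

(** * H1 as a reproducing kernel Hilbert space *)

Section H1.
Context (R : realType) (X : hilbertType R) (E : linop X) (Y : set X).
Variables (Omega : set R[i]) (F T : R[i] -> bop (hsum X X)).
Hypothesis Omega_neq0 : Omega !=set0.
Hypothesis Omega_open : open Omega.
Hypothesis E_simple : simple_op E.
Hypothesis E_symmetric : symmetric_op E.
Hypothesis Y_closed : closed_subspace Y.
Hypothesis Omega_regular : forall z, Omega z -> regular E Y z.
Local Notation K := (hsum X X).
Local Notation P := (regproj E Y).
Local Notation tau := (regtau E Y).
Local Notation c := (pi%:C%C * 'i : R[i]).
Local Notation H1f := (H1_fun E Y Omega).

Hypothesis FE : forall z x, Omega z -> F z x = (P z x.1, c^-1 *: tau z x.1).
Hypothesis F_resolvent : forall l w, Omega l -> Omega w ->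
  F l - F w = (l - w) *: (F l * T w).

Lemma H1_funE f z : Omega z -> H1f f z = F z (f, 0).
Proof. by move=> Oz; rewrite /H1_fun /zero_ext patchT ?inE// FE. Qed.

Lemma H1_fun_out f z : ~ Omega z -> H1f f z = 0.
Proof. by move=> Oz; rewrite /H1_fun /zero_ext patchC// inE. Qed.

Lemma zero_extE (f : R[i] -> K) z : Omega z -> zero_ext Omega f z = f z.
Proof. by move=> Oz; rewrite /zero_ext patchT ?inE. Qed.

Lemma zero_ext_out (f : R[i] -> K) z : ~ Omega z -> zero_ext Omega f z = 0.
Proof. by move=> Oz; rewrite /zero_ext patchC// inE. Qed.

Lemma H1_fun_linear a f g : H1f (a *: f + g) = a *: H1f f + H1f g.
Proof.
apply/funext => z; rewrite !fctE; have [Oz|Oz] := pselect (Omega z).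
  by rewrite !H1_funE// -bop_linearP; congr (F z (_, _)); rewrite /= scaler0 addr0.
by rewrite !H1_fun_out// scaler0 addr0.
Qed.

(** A single point [z] recovers [f] as [(E - z) tau z f + P z f]. *)
Lemma H1_fun_inj : injective H1f.
Proof.
move=> f g fg; have [z Oz] := Omega_neq0.
have := congr1 (fun h => h z) fg; rewrite !H1_funE// !FE//= => -[Pfg tfg].
have c0 : c != 0.
  by rewrite mulf_neq0// ?neq0Ci// -(rmorph0 (real_complex R)) (inj_eq (@complexI R)) gt_eqF// pi_gt0.
have {}tfg : tau z f = tau z g.
  by apply: (scalerI (_ : c^-1 != 0)) => //; rewrite invr_eq0.
have dec h := regular_decomposition E_simple E_symmetric Y_closed Omega_regular h Oz.
have [_ _ fE] := dec f; have [_ _ gE] := dec g.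
by rewrite [LHS]fE [RHS]gE Pfg tfg.
Qed.

Lemma H1_fdot f g : fdot (H1_space E Y Omega) (H1f f) (H1f g) = 2 * hdot f g.
Proof.
have pre h : xget 0 [set f | H1f f = H1f h] = h.
  by apply: xget_unique => // h' /H1_fun_inj.
by rewrite /= !pre.
Qed.

Lemma H1_hilbert_funspace : hilbert_funspace Omega (H1_space E Y Omega).
Proof.
have H1B f g : H1f f - H1f g = H1f (f - g).
  by rewrite [in RHS]addrC -[in RHS]scaleN1r H1_fun_linear scaleN1r addrC.
split.
- move=> _ [f _ <-]; apply/funext => z; have [Oz|Oz] := pselect (Omega z).
    by rewrite zero_extE.
  by rewrite zero_ext_out// H1_fun_out.
- exists 0 => //; apply/funext => z; have [Oz|Oz] := pselect (Omega z).
    by rewrite H1_funE// -[(0, 0)]/(0 : K) bop0.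
  by rewrite H1_fun_out.
- by move=> a _ _ [f _ <-] [g _ <-]; exists (a *: f + g) => //; rewrite H1_fun_linear.
- move=> a _ _ _ [f _ <-] [g _ <-] [h _ <-].
  by rewrite -H1_fun_linear !H1_fdot hdotDl hdotZl; ring.
- move=> _ _ [f _ <-] [g _ <-].
  by rewrite !H1_fdot rmorphM/= -hdot_conj rmorph_nat.
- move=> _ [f _ <-] H1f0; rewrite H1_fdot mulr_gt0// hdot_norm exprn_gt0//.
  rewrite normr_gt0; apply: contra_neq H1f0 => ->; apply/funext => z.
  have [Oz|Oz] := pselect (Omega z); last by rewrite H1_fun_out.
  by rewrite H1_funE// -[(0, 0)]/(0 : K) bop0.
- move=> u Hu uc.
  have /choice[v vE] : forall n, exists f, H1f f = u n.
    by move=> n; have [f _ fE] := Hu n; exists f.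
  have fuv m n : fdot (H1_space E Y Omega) (u m - u n) (u m - u n) =
      2 * `|v m - v n| ^+ 2.
    by rewrite -!vE H1B H1_fdot hdot_norm.
  have vc : cvg (v @ \oo).
    apply: cauchy_seq_cvg => e e0.
    have e2 : 0 < (2 * e ^+ 2)%:C%C :> R[i].
      by rewrite (ltcR 0) mulr_gt0// exprn_gt0.
    have [[A B]/= [[N1 _ N1A] [N2 _ N2B]] AB] := uc _ e2.
    exists (maxn N1 N2) => m n; rewrite !geq_max => /andP[m1 m2] /andP[n1 n2].
    have : fdot (H1_space E Y Omega) (u m - u n) (u m - u n) < (2 * e ^+ 2)%:C%C.
      exact: (AB (m, n) (conj (N1A _ m1) (N2B _ n2))).
    rewrite fuv rmorphM rmorph_nat ltr_pM2l// realify_normE -rmorphXn ltcR.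
    by rewrite ltr_sqr ?nnegrE ?realify_norm_ge0 ?(ltW e0)// => /ltW.
  exists (H1f (lim (v @ \oo))); first by exists (lim (v @ \oo)).
  apply/cvgrPdist_lt => e e0; set l := lim _.
  have /cvgrPdist_lt vl := vc.
  have s0 : 0 < sqrtC (e / 2) by rewrite sqrtC_gt0 divr_gt0.
  apply: filterS (vl _ s0) => n ln.
  rewrite -vE H1B H1_fdot sub0r normrN hdot_norm normrM normr_nat normrX normr_id.
  rewrite -ltr_pdivlMl// mulrC -[ltRHS]sqrtCK distrC ltr_sqr ?nnegrE//.
  exact: ltW.
Qed.

(** By the resolvent identity the difference quotient is exactly [F (h + z) (T z (g, 0))], so
    continuity of [F] is enough. *)
Lemma H1_analytic f : fcarrier (H1_space E Y Omega) f -> analytic Omega f.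
Proof.
move=> [g _ <-] z Oz; apply/cvg_ex; exists (F z (T z (g, 0))).
have lim1 : F (h + z) (T z (g, 0)) @[h --> 0^'] --> F z (T z (g, 0)).
  apply: cvg_bop_apply; exact: (resolvent_continuous Omega_open F_resolvent).
apply: cvg_trans lim1; apply: near_eq_cvg; near=> h.
have Ohz : Omega (h + z) by near: h; exact: near_add_open.
have h0 : h != 0 by near: h; exact: nbhs_dnbhs_neq.
rewrite /= /shift/= -[h%:A]/(h * 1) mulr1 !H1_funE// -opp_bopE -add_bopE.
by rewrite F_resolvent// addrK scale_bopE scalerA mulVf// scale1r.
Unshelve. all: by end_near. Qed.

(** The kernel function at [w] comes from half the first component of [adjop (F w) u]; the half
    cancels the factor 2 of the inner product. *)
Lemma H1_reproducing_kernel k : (forall w z, Omega w -> Omega z ->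
    k w z = 2^-1 *: (F z * adjop (F w))) ->
  reproducing_kernel Omega (H1_space E Y Omega) k.
Proof.
move=> kE w u Ow; set q := (adjop (F w) u).1.
have kH : zero_ext Omega (fun z => k w z u) = H1f (2^-1 *: q).
  apply/funext => z; have [Oz|Oz] := pselect (Omega z); last first.
    by rewrite zero_ext_out// H1_fun_out.
  rewrite zero_extE// H1_funE// kE// scale_bopE mul_bopE -bopZ.
  by rewrite [LHS]FE// [RHS]FE.
split; first by rewrite kH; exists (2^-1 *: q).
move=> _ [f _ <-]; rewrite kH H1_fdot hdotZr fmorphV rmorph_nat mulVKf ?pnatr_eq0//.
by rewrite H1_funE// adjopP hsum_hdotE/= hdot0l addr0.
Qed.

(** The double sum is a Gram sum, half the squared norm of [v]. *)
Lemma positive_kernel_factorization k : (forall w z, Omega w -> Omega z ->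
    k w z = 2^-1 *: (F z * adjop (F w))) -> positive_kernel Omega k.
Proof.
move=> kE n w u Ow; pose v := \sum_j adjop (F (w j)) (u j).
have -> : \sum_(i < n) \sum_(j < n) hdot (k (w j) (w i) (u j)) (u i) =
    2^-1 * hdot v v.
  rewrite {2}/v hdot_sumr mulr_sumr; apply: eq_bigr => i _.
  rewrite hdot_suml mulr_sumr; apply: eq_bigr => j _.
  by rewrite kE// scale_bopE hdotZl mul_bopE [in LHS]adjopP.
by rewrite mulr_ge0// ?invr_ge0// hdot_norm exprn_ge0.
Qed.

End H1.

Theorem theorem3p6 (R : realType) (X : hilbertType R) (E : linop X)
    (Y : set X) (Omega : set R[i])
    (X_separable : separable X)
    (X_infinite : infinite_dimensional [set: X])
    (E_simple : simple_op E)
    (E_closed : closed_op E)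
    (E_dense : densely_defined E)
    (E_symmetric : symmetric_op E)
    (E_deficiency : infinite_deficiency_indices E)
    (Y_closed : closed_subspace Y)
    (Y_infinite : infinite_dimensional Y)
    (Omega_neq0 : Omega !=set0)
    (Omega_open : open Omega)
    (Omega_conj : forall z, Omega z -> Omega z^*)
    (Omega_regular : forall z, Omega z -> regular E Y z) :
  H0U_space Omega (J1 X) (H1_space E Y Omega).
Proof.
have [F [T [FE FR FB]]] := model_exists E_simple E_closed E_symmetric Y_closed
  Omega_conj Omega_regular.
have [a [W [Oa UP]]] := kernel_factorization Omega_open Omega_conj (J1_adj X)
  (J1_sqr X) FR FB Omega_neq0.
pose U s z := s *: ((J1 X + (pi%:C%C * 'i * (z - a^*)) *: (F z * adjop (F a))) * W * J1 X).
have HU s : s * s^* = 1 -> HU_space Omega (J1 X) (U s) (H1_space E Y Omega).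
  move=> /UP[Ua UJ UK]; split => //.
  - by rewrite /unitary_op /selfadjoint_op J1_adj !compopE J1_sqr.
  - exact: positive_kernel_factorization UK.
  - split; first exact: H1_hilbert_funspace FE.
      exact: H1_analytic FR.
    exact: H1_reproducing_kernel UK.
have [z0 Oz0] := Omega_neq0.
have Yoc : infinite_dimensional (orthocompl Y).
  apply: (@orthocompl_infinite _ _ E Y z0) => //; first by case: (Omega_regular _ Oz0) => _ [].
  by move=> x; exact: regular_injective.
have [e eo eY] := orthonormal_seq_exists (orthocompl_subspace Y) Yoc.
(* First components of values of [F z] lie in [Y], so these vectors are orthogonal to the range of
   every [F z]. *)
pose e' n : hsum X X := (e n, 0).
have eo' : orthonormal_seq e'.
  by move=> i j; rewrite hsum_hdotE/= hdot0l addr0.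
(* Failure of [s = 1] provides only one point [z1], whereas [s = -1] must be checked at every [z];
   [Ue] bridges the two, as its right side does not depend on the point. *)
have [nc1|/existsNP[z1 /not_implyP[Oz1 /contrapT c1]]] :=
    pselect (forall z, Omega z -> ~ compact_op (idop (hsum X X) - U 1 z)).
  by exists (U 1) => //; apply: HU; rewrite rmorph1 mulr1.
exists (U (-1)); first by apply: HU; rewrite rmorphN rmorph1 mulrNN mulr1.
move=> z Oz; apply: (compact_op_sum_neq eo' _ c1) => n.
have Ue s z' x : Omega z' -> hdot (U s z' x) (e' n) = s * hdot (J1 X (W (J1 X x))) (e' n).
  move=> Oz'; rewrite /U scale_bopE hdotZl; congr (_ * _).
  set v := W (J1 X x); set g := adjop (F a) v.
  have -> : ((J1 X + (pi%:C%C * 'i * (z' - a^*)) *: (F z' * adjop (F a))) * W * J1 X) x =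
      J1 X v + (pi%:C%C * 'i * (z' - a^*)) *: F z' g by [].
  have [_ Yg _] := regular_decomposition E_simple E_symmetric Y_closed
    Omega_regular g.1 Oz'.
  have Fg : hdot (F z' g) (e' n) = 0.
    by rewrite FE// hsum_hdotE/= hdot0r addr0 hdot_conj eY// rmorph0.
  by rewrite hdotDl hdotZl Fg mulr0 addr0.
(* With [q] the common diagonal entry, the two contributions are [1 - q] and [1 + q]. *)
rewrite !add_bopE !opp_bopE idopE one_bopE hdotDl !hdotBl !Ue//.
rewrite eo' eqxx mulr1n mulN1r mul1r opprK; move: (hdot _ _) => q; ring.
Qed.
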